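(* Let $m,n\ge 1$ and $N\ge 0$ be integers and let $z=(z_1,\dots,z_n)$, $w=(w_1,\dots,w_m)$ and $a_1,\dots,a_{m+n}$ be nonzero complex parameters, such that no denominator in the identity below vanishes. Assume $$w_1\cdots w_m=z_1\cdots z_n\,a_1\cdots a_{m+n}.$$ Then $$\sum_{\substack{y_1,\dots,y_n\geq 0\\ y_1+\dots+y_n=N}} \frac{\Delta(zq^y)}{\Delta(z)}\prod_{k=1}^n\frac{\prod_{j=1}^{m+n}(a_jz_k)_{y_k}} {\prod_{j=1}^m(w_jz_k)_{y_k}\prod_{j=1}^n(qz_k/z_j)_{y_k}} =\sum_{\substack{y_1,\dots,y_m\geq 0\\ y_1+\dots+y_m=N}} \frac{\Delta(wq^y)}{\Delta(w)} \prod_{k=1}^m\frac{\prod_{j=1}^{m+n}(w_k/a_j)_{y_k}} {\prod_{j=1}^n(w_kz_j)_{y_k}\prod_{j=1}^m(qw_k/w_j)_{y_k}},$$ where the summation indices $y_k$ are integers.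
   Context: Fix complex numbers $p$ with $|p|<1$ and $q\neq 0$. The theta function is $\theta(x)=\prod_{j=0}^\infty(1-p^jx)(1-p^{j+1}/x)$ for $x\neq 0$. The elliptic Pochhammer symbol is $(a)_k=\theta(a)\theta(aq)\cdots\theta(aq^{k-1})$ for integers $k\ge 0$, with $(a)_0=1$. For a vector $z=(z_1,\dots,z_n)$ put $\Delta(z)=\prod_{1\le j<k\le n}z_j\,\theta(z_k/z_j)$ (equal to $1$ if $n=1$), and for $y=(y_1,\dots,y_n)$ let $zq^y=(z_1q^{y_1},\dots,z_nq^{y_n})$, so that $$\frac{\Delta(zq^y)}{\Delta(z)}=\prod_{1\le j<k\le n}q^{y_j}\frac{\theta(z_kq^{y_k}/z_jq^{y_j})}{\theta(z_k/z_j)}.$$ *)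

(* Defs.v *)
From mathcomp Require Import all_boot all_order all_algebra.
From mathcomp Require Import complex.
From mathcomp Require Import all_classical all_reals all_analysis.
Import numFieldNormedType.Exports.

Set Implicit Arguments.
Unset Strict Implicit.
Unset Printing Implicit Defensive.

Import Order.TTheory GRing.Theory Num.Theory.
Local Open Scope classical_set_scope.
Local Open Scope ring_scope.

(* The definitions take a general numFieldType [K], whose topology is the one
   induced by its norm; for [K := R[i]] this is the usual topology on the
   complex numbers. *)

(* [lim] is total in MathComp-Analysis; over [R[i]] the partial products
   converge whenever [`|p| < 1] and [x != 0]. *)
Definition theta (K : numFieldType) (p x : K) : K :=
  lim ((fun N : nat =>
          \prod_(0 <= j < N) ((1 - p ^+ j * x) * (1 - p ^+ j.+1 / x))) @ \oo).

Definition ellpoch (K : numFieldType) (p q a : K) (k : nat) : K :=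
  \prod_(0 <= i < k) theta p (a * q ^+ i).

Definition Delta (K : numFieldType) (p : K) (n : nat) (z : 'I_n -> K) : K :=
  \prod_(j < n) \prod_(k < n | (j < k)%N) (z j * theta p (z k / z j)).

(* A summation index [y] is coded with entries in ['I_N.+1], which loses nothing:
   nonnegative integers of sum [N] are at most [N]. *)
Definition composition (n N : nat) (y : {ffun 'I_n -> 'I_N.+1}) : bool :=
  (\sum_(k < n) y k == N)%N.

(* Main.v *)
(** The identity is proved by induction on [N], for any function [th] that
satisfies the inversion formula and the three-term relation of theta functions.
The three-term relation gives Lagrange interpolation and elliptic partial
fractions; the latter is the case [N = 1].  Write the left side as
[F_N(z, w, a)].  Interpolating the dependence on [a_1 = q b] at the points
[1 / z_k] expresses [F_N] as a combination over [k] of the sums [F_{N-1}] in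
which [z_k] is replaced by [q z_k] and [a_1] by [b].  Apply the induction
hypothesis to each of them, then the case [N = 1] to the resulting sum over [k]
with [w q^y] in place of [w] and [q^N b] in place of [a_1].  This produces
a sum over one more step [y -> y + e_i] on the dual side, which the same
interpolation formula, now at the points [w_i q^(y_i)], collects into the right
side for [N].

The three-term relation for the product [theta p] comes from the Jacobi triple
product: multiplying the series for [theta (x y)] and [theta (x / y)] and
splitting the double sum by parity gives
[theta (x y) * theta (x / y) = c x (B x * A y - A x * B y)] for two functions
[A] and [B], and such antisymmetric forms of rank two satisfy the Pluecker
relation. *)

Require Import Defs.
From mathcomp Require Import all_boot all_order all_algebra.
From mathcomp Require Import complex.
From mathcomp Require Import all_classical all_reals all_analysis.
From mathcomp Require Import ring lra zify.

Set Implicit Arguments.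
Unset Strict Implicit.
Unset Printing Implicit Defensive.

Import Order.TTheory GRing.Theory Num.Theory.
Import numFieldNormedType.Exports.
Local Open Scope ring_scope.
Local Open Scope complex_scope.

(** * Interpolation and partial fractions *)

(** Only the denominators of the statement are assumed nonzero, so the [a_j] may sit at zeros of
    theta factors and no general position is available. Identities are therefore kept multiplied
    through by factors such as [th t], and the factor [th (q ^+ N)] divided out in the recursion is
    nonzero because [(q z_k / z_k)_N] is itself a denominator. The induction behind interpolation
    still has to avoid a zero when it picks a node; it can, because the zeros of theta form a
    multiplicative group. On the analytic side every limit comes with an explicit geometric error,
    which makes sums, products and uniqueness of limits elementary. The series [A] and [B] are never
    shown to converge: the Pluecker relation holds for their truncations and passes to the limit.
    The triple product divides by powers of [p], so [p = 0], where theta is [1 - x], is treated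
    apart. *)

Ltac nonzero :=
  rewrite ?(mulf_eq0, invr_eq0, negb_or); repeat (apply/andP; split) => //.

Section ThetaAlgebra.
Variables (K : fieldType) (th : K -> K).

(* The last clause is the Weierstrass addition formula in a form free of square
   roots: [A = x y], [B = x / y], [C = u v] and [E = x v]. *)
Definition theta_like : Prop :=
  [/\ th 1 = 0,
      forall x, x != 0 -> th x^-1 = - (th x / x),
      forall a b, a != 0 -> b != 0 -> th a = 0 -> th b = 0 -> th (a / b) = 0 &
      forall A B C E, A != 0 -> B != 0 -> C != 0 -> E != 0 ->
        th A * th B * th C * th (A * B * C / E ^+ 2)
        - th E * th (A * B / E) * th (A * C / E) * th (B * C / E)
        = B * C / E * th (E / B) * th (A / E) * th (A * B * C / E) * th (E / C)].

Hypothesis thP : theta_like.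

Lemma th1 : th 1 = 0. Proof. by case: thP. Qed.

Lemma thV x : x != 0 -> th x^-1 = - (th x / x).
Proof. by case: thP => _ + _ _; apply. Qed.

Lemma th_div_swap x y : x != 0 -> y != 0 -> th (x / y) = - (x / y * th (y / x)).
Proof.
move=> x0 y0; rewrite -[x / y]invf_div thV; last by rewrite mulf_neq0 ?invr_neq0.
by rewrite invf_div mulrC.
Qed.

Lemma th_div_neq0 x y : x != 0 -> y != 0 -> (th (x / y) != 0) = (th (y / x) != 0).
Proof.
by move=> x0 y0; rewrite th_div_swap // oppr_eq0 !mulf_eq0 invr_eq0 (negbTE x0) (negbTE y0).
Qed.

(** The addition formula with [A = t], [B = xl / xk], [C = t * xl * xk / (c * s)] and
    [E = t * xl / c], arranged for the step of the interpolation that removes the node [xl] and the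
    parameter [c]. *)
Lemma th_three_term t xl xk c s :
  t != 0 -> xl != 0 -> xk != 0 -> c != 0 -> s != 0 ->
  th t * th (xl / xk) * th (t * xl / c * xk / s) * th (c / s) =
  th (t * xl / c) * th (c / xk) * th (t * xk / s) * th (xl / s)
  - xl / xk * th (t * xl / c * xk / xl) * th (c / xl) * th (xk / s) * th (t * xl / s).
Proof.
move=> t0 l0 k0 c0 s0; case: thP => _ _ _ add.
have := add t (xl / xk) (t * xl * xk / (c * s)) (t * xl / c).
have nz : [&& xl / xk != 0, t * xl * xk / (c * s) != 0 & t * xl / c != 0].
  by rewrite !mulf_neq0 ?invr_neq0 ?mulf_neq0.
case/and3P: nz => n1 n2 n3 /(_ t0 n1 n2 n3).
have -> : t * (xl / xk) * (t * xl * xk / (c * s)) / (t * xl / c) ^+ 2 = c / s.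
  by field; rewrite ?t0 ?l0 ?k0 ?c0 ?s0.
have -> : t * (xl / xk) / (t * xl / c) = c / xk by field; rewrite ?t0 ?l0 ?k0 ?c0 ?s0.
have -> : t * (t * xl * xk / (c * s)) / (t * xl / c) = t * xk / s.
  by field; rewrite ?t0 ?l0 ?k0 ?c0 ?s0.
have -> : xl / xk * (t * xl * xk / (c * s)) / (t * xl / c) = xl / s.
  by field; rewrite ?t0 ?l0 ?k0 ?c0 ?s0.
have -> : t * xl / c / (xl / xk) = t * xl / c * xk / xl by field; rewrite ?t0 ?l0 ?k0 ?c0 ?s0.
have -> : t / (t * xl / c) = c / xl by field; rewrite ?t0 ?l0 ?k0 ?c0 ?s0.
have -> : t * (xl / xk) * (t * xl * xk / (c * s)) / (t * xl / c) = t * xl / s.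
  by field; rewrite ?t0 ?l0 ?k0 ?c0 ?s0.
have -> : t * xl / c / (t * xl * xk / (c * s)) = s / xk by field; rewrite ?t0 ?l0 ?k0 ?c0 ?s0.
have -> : t * xl * xk / (c * s) = t * xl / c * xk / s by field; rewrite ?t0 ?l0 ?k0 ?c0 ?s0.
rewrite (@th_div_swap s xk) // => /(canRL (subrK _)) ->.
by field; rewrite ?t0 ?l0 ?k0 ?c0 ?s0.
Qed.

(** As functions of [s], all the products [th (t * x k / s) * \prod_j th (x j / s)] and
    [\prod_c th (c / s)] have the same quasi-periodicity, since their parameters always multiply to
    [\prod_c c]. This is Lagrange interpolation at the points [s = x k]; the usual division by
    [th t] is avoided, so [th t = 0] is allowed. *)
Lemma th_interpolation (I : finType) (x : I -> K) (S : {set I}) (cs : seq K) (s : K) :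
  size cs = #|S| -> s != 0 -> (forall k, x k != 0) -> all (fun c => c != 0) cs ->
  {in S &, forall j k, j != k -> th (x j / x k) != 0} ->
  let t := (\prod_(c <- cs) c) / \prod_(k in S) x k in
  \sum_(k in S) (\prod_(c <- cs) th (c / x k)) / (\prod_(j in S :\ k) th (x j / x k))
     * (th (t * x k / s) * \prod_(j in S :\ k) th (x j / s))
  = th t * \prod_(c <- cs) th (c / s).
Proof.
move=> + + x0; elim: cs S s => [|c cs IH] S s.
  move=> /esym/cards0_eq -> _ _ _ /=.
  by rewrite !big_set0 big_nil invr1 mulr1 th1 mul0r.
move=> /= szS s0 /andP[c0 cs0] xS.
set t := _ / _.
have tE : t = (\prod_(c1 <- c :: cs) c1) / \prod_(k in S) x k by [].
clearbody t.
have P0 T : \prod_(k in T) x k != 0 by apply/prodf_neq0 => k _.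
have C0 : \prod_(c <- cs) c != 0 by rewrite prodf_seq_neq0; apply: sub_all cs0 => ? ->.
have t0 : t != 0 by rewrite tE big_cons; nonzero.
have : (0 < #|S|)%N by rewrite -szS.
case/card_gt0P => l1 Sl1.
have [S1|S1] := eqVneq (size cs) 0%N.
  have /eqP : #|S| = 1%N by rewrite -szS S1.
  case/cards1P => l Sl; rewrite tE Sl !big_set1 (size0nil S1) !big_seq1.
  rewrite finset.setDv !big_set0 invr1 !mulr1.
  by rewrite divfK.
(* The removed node [x l] must have [th (t * x l / c) != 0]; this cannot fail for
   two nodes, whose quotient is not a zero of [th]. *)
have [l Sl tl] : exists2 l, l \in S & th (t * x l / c) != 0.
  have [e1|] := eqVneq (th (t * x l1 / c)) 0; last by exists l1.
  have /card_gt0P[l2] : (0 < #|S :\ l1|)%N.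
    by move: szS; rewrite (cardsD1 l1) Sl1 add1n => -[<-]; rewrite lt0n.
  rewrite !inE => /andP[l21 Sl2]; exists l2 => //; apply/negP => /eqP e2.
  have := xS _ _ Sl2 Sl1 l21; apply/negP; rewrite negbK; apply/eqP.
  have -> : x l2 / x l1 = (t * x l2 / c) / (t * x l1 / c).
    by field; rewrite c0 x0 t0.
  case: thP => _ _ grp _; by apply: (grp _ _ _ _ e2 e1); nonzero.
have szS' : size cs = #|S :\ l| by move: szS; rewrite (cardsD1 l) Sl add1n => -[].
have xS' : {in S :\ l &, forall j k, j != k -> th (x j / x k) != 0}.
  by move=> j k; rewrite !inE => /andP[_ Sj] /andP[_ Sk]; apply: xS.
have {}IH u (u0 : u != 0) := IH _ u szS' u0 cs0 xS'.
set t' := (\prod_(c <- cs) c) / _ in IH.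
have t'E : t' = (\prod_(c1 <- cs) c1) / \prod_(k in S :\ l) x k by [].
clearbody t'.
have {}t'E : t' = t * x l / c.
  by rewrite t'E tE big_cons (big_setD1 _ Sl) /=; field; rewrite P0 x0 c0.
rewrite -t'E in tl.
(* Times [th t'], the right side contains the right side of the shorter formula at [s]. The
   three-term relation turns each summand of that formula into the wanted one plus a multiple, with
   coefficient free of [k], of the summand of the shorter formula at [s = x l]. The induction
   hypothesis sums the latter to the missing term of index [l]. *)
apply: (mulfI tl); rewrite big_cons.
pose P k := \prod_(c <- cs) th (c / x k).
pose D k := \prod_(j in S :\ l :\ k) th (x j / x k).
pose M k u := \prod_(j in S :\ l :\ k) th (x j / u).
pose M' u := \prod_(j in S :\ l) th (x j / u).
have M'E k u : k \in S :\ l -> M' u = th (x k / u) * M k u.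
  by move=> Sk; rewrite /M' (big_setD1 k).
have M'l : M' (x l) != 0.
  by apply/prodf_neq0 => j; rewrite !inE => /andP[jl Sj]; apply: xS.
rewrite (big_setD1 _ Sl) /= !big_cons.
have -> : th t' * (th t * (th (c / s) * \prod_(j <- cs) th (j / s)))
  = th t * th (c / s) * (th t' * \prod_(j <- cs) th (j / s)) by ring.
rewrite -(IH s s0) mulr_sumr.
rewrite [RHS](eq_bigr (fun k => th t' * ((th (c / x k) * P k) / (\prod_(j in S :\ k) th (x j / x k))
     * (th (t * x k / s) * \prod_(j in S :\ k) th (x j / s))) +
     M' s * th (c / x l) * th (t * x l / s) / M' (x l) *
     (P k / D k * (th (t' * x k / x l) * M k (x l))))); last first.
  move=> k Sk; have := Sk; rewrite !inE => /andP[kl Skk].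
  have SkE : S :\ k = l |: (S :\ l :\ k).
    by apply/finset.setP => j; rewrite !inE; case: (eqVneq j l) => //= ->; rewrite eq_sym kl Sl.
  have lN : l \notin S :\ l :\ k by rewrite !inE eqxx andbF.
  rewrite !SkE !(big_setU1 _ lN) /= -/(D k) -/(M k s) -/(P k).
  have xlk : th (x l / x k) != 0 by apply: xS; rewrite // eq_sym.
  have Dk : D k != 0.
    by apply/prodf_neq0 => j; rewrite !inE => /and3P[jk jl Sj]; apply: xS.
  have xkl : th (x k / x l) != 0 by apply: xS.
  have := th_three_term t0 (x0 l) (x0 k) c0 s0; rewrite -t'E => E3.
  have -> : th t * th (c / s) * (P k / D k * (th (t' * x k / s) * M k s)) =
     th t * th (x l / x k) * th (t' * x k / s) * th (c / s) * (P k / D k * M k s / th (x l / x k)).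
    by field; rewrite xlk Dk.
  rewrite E3 (M'E k s) // (M'E k (x l)) // [th (x l / x k)]th_div_swap //.
  have Mk0 : M k (x l) != 0 by apply: contraNneq M'l => M0; rewrite (M'E k) // M0 mulr0.
  by field; rewrite Dk Mk0 xkl !x0 oppr_eq0 mulf_neq0.
rewrite big_split /= -!mulr_sumr (IH (x l)) // -/(P l) -/(M' s) -/(M' (x l)).
rewrite mulrDr addrC; congr (_ + _); first by field; rewrite M'l.
by congr (_ * _); apply: eq_bigr => k _; rewrite big_cons.
Qed.

(** Interpolation with one node [x l] taken out and used as the point [s], and one parameter [c]
    dropped. The balancing condition gives [t = x l / c], and the right side is the term of index
    [l]. *)
Lemma th_partial_fraction (I : finType) (x : I -> K) (cs : seq K) :
  size cs = #|I| -> (forall k, x k != 0) -> all (fun c => c != 0) cs ->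
  (forall j k, j != k -> th (x j / x k) != 0) ->
  \prod_(c <- cs) c = \prod_k x k ->
  \sum_k (\prod_(c <- cs) th (c / x k)) / (\prod_(j | j != k) th (x j / x k)) = 0.
Proof.
case: cs => [|c cs] szI x0.
  by move=> _ _ _; apply: big1 => k _; have := fintype0 k (esym szI).
move=> /= /andP[c0 cs0] xI eqp.
have /card_gt0P[l _] : (0 < #|I|)%N by rewrite -szI.
have szS : size cs = #|[set~ l]| by rewrite cardsC1 -szI.
have := th_interpolation szS (x0 l) x0 cs0 (fun j k _ _ => xI j k).
set t := _ / _; have -> : t = x l / c.
  have S0 : \prod_(k in [set~ l]) x k != 0 by apply/prodf_neq0 => k _.
  have predE : \prod_(k in [set~ l]) x k = \prod_(k | k != l) x k.
    by apply: eq_bigl => k; rewrite !inE.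
  move: eqp; rewrite /t big_cons (bigD1 l) //= -predE.
  by move=> E; apply: (mulfI c0); rewrite mulrA E; field; rewrite S0 c0.
clear t => LG.
pose M := \prod_(j | j != l) th (x j / x l).
have M0 : M != 0 by apply/prodf_neq0 => j; apply: xI.
have rl : M * (x l / c) != 0 by nonzero.
apply: (mulfI rl); rewrite mulr0 mulr_sumr (bigD1 l) //= big_cons.
rewrite -/M; apply/eqP; rewrite addr_eq0; apply/eqP.
have -> : M * (x l / c) * (th (c / x l) * \prod_(c <- cs) th (c / x l) / M)
   = - (th (x l / c) * \prod_(c <- cs) th (c / x l)).
  by rewrite [th (x l / c)]th_div_swap //; field; rewrite M0 c0.
rewrite -LG; congr (- _); apply: eq_big => [k|k]; rewrite ?inE // => kl.
have predE (F : I -> K) : \prod_(j in [set~ l] :\ k) F j = \prod_(j | (j != k) && (j != l)) F j.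
  by apply: eq_bigl => j; rewrite !inE.
rewrite big_cons !predE [\prod_(j | j != k) _](bigD1 l) 1?eq_sym //=.
have -> : M = th (x k / x l) * \prod_(j | (j != k) && (j != l)) th (x j / x l).
  by rewrite /M (bigD1 k) //=; congr (_ * _); apply: eq_bigl => j; rewrite andbC.
have -> : x l / c * x k / x l = x k / c by field; rewrite c0 x0.
rewrite [th (x k / c)]th_div_swap // [th (x k / x l)]th_div_swap //.
have lk : th (x l / x k) != 0 by rewrite xI // eq_sym.
have D0 : \prod_(j | (j != k) && (j != l)) th (x j / x k) != 0.
  by apply/prodf_neq0 => j /andP[jk _]; apply: xI.
by field; rewrite c0 !x0 lk D0.
Qed.

(** Partial fractions over the nodes [1 / z k] and [w i] taken together; each group of nodes yields
    one side. *)
Lemma th_duality1 (I J : finType) (z : I -> K) (w : J -> K) (cs : seq K) :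
  size cs = (#|J| + #|I|)%N ->
  (forall k, z k != 0) -> (forall i, w i != 0) -> all (fun c => c != 0) cs ->
  (forall j k, j != k -> th (z k / z j) != 0) ->
  (forall j k, j != k -> th (w k / w j) != 0) ->
  (forall i k, th (w i * z k) != 0) ->
  \prod_i w i = \prod_k z k * \prod_(c <- cs) c ->
  \sum_k (\prod_(c <- cs) th (c * z k)) /
      ((\prod_(j | j != k) th (z k / z j)) * \prod_i th (w i * z k)) =
  \sum_i (\prod_(c <- cs) th (w i / c)) /
      ((\prod_(j | j != i) th (w i / w j)) * \prod_k th (w i * z k)).
Proof.
move=> szc z0 w0 c0 zz ww wz eqp.
pose x (u : I + J) := match u with inl k => (z k)^-1 | inr i => w i end.
have x0 u : x u != 0 by case: u => [k|i] /=; rewrite ?invr_eq0.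
have xI u v : u != v -> th (x u / x v) != 0.
  case: u v => [j|j] [k|k] /= uv.
  - by rewrite invrK mulrC; apply: zz; apply: contraNneq uv => ->.
  - rewrite -invfM thV ?mulf_neq0 // oppr_eq0; rewrite mulrC; nonzero.
    by rewrite mulrC wz.
  - by rewrite invrK wz.
  - by apply: ww; apply: contraNneq uv => ->.
have szx : size cs = #|{: I + J}| by rewrite card_sum addnC.
have Z0 : \prod_k z k != 0 by apply/prodf_neq0 => k _.
have eqx : \prod_(c <- cs) c = \prod_u x u by rewrite big_sumType /= prodfV eqp mulKf.
have := th_partial_fraction szx x0 c0 xI eqx; rewrite big_sumType /= => /eqP.
rewrite addr_eq0 => /eqP eq0; apply: etrans (etrans _ eq0) _; last clear eq0.
  apply: eq_bigr => k _; rewrite big_sumType /=; congr (_ / (_ * _)).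
  - by apply: eq_bigr => c _; rewrite invrK.
  - by apply: eq_big => [j|j _]; rewrite ?invrK 1?mulrC.
  - by apply: eq_bigr => i _; rewrite invrK.
rewrite -sumrN; apply: eq_bigr => i _; rewrite big_sumType /=.
(* Each inversion towards [th (w i / _)] costs one [r] and a monomial: [m + n] of them above,
   [n + (m - 1)] below. By the balancing condition what is left over is [w i * r = -1], the sign of
   moving the sum across. *)
set r := - (w i)^-1.
have swap a b : a != 0 -> b != 0 -> th (a / b) = a * - b^-1 * th (b / a).
  by move=> a0 b0; rewrite th_div_swap // mulrN mulNr.
have -> : \prod_(c <- cs) th (c / w i) =
    (\prod_(c <- cs) c) * r ^+ size cs * \prod_(c <- cs) th (w i / c).
  elim: (cs) c0 => [|c s IH] /=; first by rewrite !big_nil !mulr1.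
  by case/andP=> c0 /IH E; rewrite !big_cons E swap // exprS -/r; ring.
have -> : \prod_k th ((z k)^-1 / w i) =
    (\prod_k z k)^-1 * r ^+ #|I| * \prod_k th (w i * z k).
  rewrite -prodfV -prodr_const -!big_split /=; apply: eq_bigr => k _.
  by rewrite swap ?invr_eq0 // invrK.
have -> : \prod_(j | j != i) th (w j / w i) =
    (\prod_(j | j != i) w j) * r ^+ #|J|.-1 * \prod_(j | j != i) th (w i / w j).
  rewrite -(cardC1 i) -prodr_const -!big_split /=.
  by apply: eq_big => [j|j _]; rewrite ?inE // swap.
have J0 : (0 < #|J|)%N by apply/card_gt0P; exists i.
have -> : size cs = (#|J|.-1 + #|I| + 1)%N by rewrite szc -[in LHS](prednK J0); lia.
rewrite !exprD expr1.
have r0 n : r ^+ n != 0 by rewrite expf_neq0 // oppr_eq0 invr_eq0.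
have W0 : \prod_(j | j != i) w j != 0 by apply/prodf_neq0 => j _.
have T0 : \prod_(j | j != i) th (w i / w j) != 0.
  by apply/prodf_neq0 => j ji; apply: ww.
have T1 : \prod_k th (w i * z k) != 0 by apply/prodf_neq0 => j ji; apply: wz.
move: eqp; rewrite (bigD1 i) //= => eqp.
have -> : \prod_(c <- cs) c = (\prod_k z k)^-1 * (w i * \prod_(j | j != i) w j).
  by rewrite eqp mulKf.
rewrite /r; move: (r0 #|J|.-1) (r0 #|I|).
rewrite -/r; move: (r ^+ _) (r ^+ _) => r1 r2 r10 r20; rewrite /r.
by field; rewrite !w0 T0 T1 r10 r20 W0 Z0.
Qed.

End ThetaAlgebra.

(** * The duality for abstract theta functions *)

Section Duality.
Variables (K : fieldType) (th : K -> K) (q : K).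
Hypothesis thP : theta_like th.
Hypothesis q0 : q != 0.

(** Indices outside [S] contribute the same factor [th (x j / x k)] above and below, so products
    over the whole index type may replace products over [S]. This fits shifts [z q^y] in which some
    [y k] vanish. *)
Lemma th_interpolation_sub (I : finType) (x c : I -> K) (S : {set I}) (s : K) :
  s != 0 -> (forall k, x k != 0) -> (forall k, c k != 0) ->
  (forall j k, j != k -> th (x j / x k) != 0) ->
  (forall k, k \notin S -> c k = x k) ->
  let t := (\prod_k c k) / \prod_k x k in
  \sum_(k in S) (\prod_j th (c j / x k)) / (\prod_(j | j != k) th (x j / x k))
     * (th (t * x k / s) * \prod_(j in S :\ k) th (x j / s))
  = th t * \prod_(k in S) th (c k / s).
Proof.
move=> s0 x0 c0 xx cx.
have all0 : all (fun u => u != 0) [seq c j | j <- enum S].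
  by apply/allP => _ /mapP[j _ ->].
have szc : size [seq c j | j <- enum S] = #|S| by rewrite size_map -cardE.
have := th_interpolation thP szc s0 x0 all0 (fun j k _ _ => xx j k).
have prodE (f : K -> K) : \prod_(u <- [seq c j | j <- enum S]) f u = \prod_(j in S) f (c j).
  by rewrite big_map big_enum.
have prodS (f g : I -> K) : (forall j, j \notin S -> f j = g j) ->
    \prod_j f j = (\prod_(j in S) f j) * \prod_(j | j \notin S) g j.
  by move=> fg; rewrite (bigID (mem S)) /=; congr (_ * _); apply: eq_bigr.
have prodE1 : \prod_(u <- [seq c j | j <- enum S]) u = \prod_(j in S) c j.
  by rewrite big_map big_enum.
rewrite prodE1 prodE.
set t := _ / _ => E t'; have -> : t' = t.
  rewrite /t' (prodS c x cx) (prodS x x) // /t.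
  have ? : \prod_(k in S) x k != 0 by apply/prodf_neq0.
  have ? : \prod_(k | k \notin S) x k != 0 by apply/prodf_neq0.
  by field; apply/andP.
rewrite -E; apply: eq_bigr => k Sk; rewrite prodE; congr (_ * _).
rewrite (prodS _ (fun j => th (x j / x k))); last by move=> j /cx ->.
rewrite (bigID (mem S) (fun j => j != k)) /=.
have -> : \prod_(j | (j != k) && (j \notin S)) th (x j / x k) =
          \prod_(j | j \notin S) th (x j / x k).
  by apply: eq_bigl => j; case: eqVneq => [->|]; rewrite ?Sk.
have -> : \prod_(j | (j != k) && (j \in S)) th (x j / x k) =
          \prod_(j in S :\ k) th (x j / x k) by apply: eq_bigl => j; rewrite !inE.
have T0 : \prod_(j | j \notin S) th (x j / x k) != 0.
  by apply/prodf_neq0 => j jS; apply: xx; apply: contraNneq jS => ->.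
have T1 : \prod_(j in S :\ k) th (x j / x k) != 0.
  by apply/prodf_neq0 => j; rewrite !inE => /andP[jk _]; apply: xx.
by field; rewrite T0 T1.
Qed.

(** * Weights of the two sums and their one-step shifts *)

Definition poch a k := \prod_(0 <= i < k) th (a * q ^+ i).
Definition delta n (z : 'I_n -> K) :=
  \prod_(j < n) \prod_(k < n | (j < k)%N) (z j * th (z k / z j)).
Definition qshift n (z : 'I_n -> K) (y : 'I_n -> nat) (k : 'I_n) := z k * q ^+ y k.
Definition unit_at n (k j : 'I_n) : nat := (j == k).
Definition incr n (k : 'I_n) (y : 'I_n -> nat) (j : 'I_n) := (unit_at k j + y j)%N.
Definition decr n (k : 'I_n) (y : 'I_n -> nat) (j : 'I_n) := (y j - unit_at k j)%N.
Definition pochs n (z : 'I_n -> K) y := \prod_k \prod_j poch (q * z k / z j) (y k).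
Definition weight n (z : 'I_n -> K) y := delta (qshift z y) / delta z / pochs z y.
(* With [g t = prod_j th (a_j t) / prod_j th (w_j t)] the product [weight z y * onebody g z y]
   is the term of index [y] of the left side. *)
Definition onebody (g : K -> K) n (z : 'I_n -> K) (y : 'I_n -> nat) :=
  \prod_k \prod_(0 <= i < y k) g (z k * q ^+ i).

(* Equivalent to the nonvanishing of [Delta z] and of the factors [(q z_k / z_j)_{y_k}]
   in the denominators of the terms with [y_1 + ... + y_n = N]. *)
Definition nonresonant n N (z : 'I_n -> K) :=
  forall j k i, (i <= N)%N -> (j != k) || (0 < i)%N -> th (z k * q ^+ i / z j) != 0.

Lemma incrK n (k : 'I_n) (y : 'I_n -> nat) : (0 < y k)%N -> incr k (decr k y) = y.
Proof.
move=> yk; apply/funext => j; rewrite /incr /decr /unit_at.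
by case: eqVneq => [->|_]; lia.
Qed.

(** Two readings of [y + e_k]: the step at [k] is taken before [y], moving the base point, or after
    it. The left side of the duality is reduced by the first, the right side by the second. *)
Lemma qshift_incr n (k : 'I_n) (z : 'I_n -> K) y :
  qshift z (incr k y) = qshift (qshift z (unit_at k)) y.
Proof. by apply/funext => j; rewrite /qshift /incr exprD mulrA. Qed.

Lemma qshift_incr_last n (k : 'I_n) (z : 'I_n -> K) y :
  qshift z (incr k y) = qshift (qshift z y) (unit_at k).
Proof. by apply/funext => j; rewrite /qshift /incr addnC exprD mulrA. Qed.

Lemma poch_recl a k : poch a k.+1 = th a * poch (q * a) k.
Proof.
rewrite /poch big_nat_recl // expr0 mulr1; congr (_ * _).
by apply: eq_bigr => i _; rewrite exprS mulrCA mulrA.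
Qed.

Lemma poch_recr a k : poch a k.+1 = poch a k * th (a * q ^+ k).
Proof. by rewrite /poch big_nat_recr. Qed.

Lemma poch_shift a k : poch (q * a) k * th a = poch a k * th (a * q ^+ k).
Proof. by rewrite mulrC -poch_recl poch_recr. Qed.

Lemma prod_pairs_with n (k : 'I_n) (d : 'I_n -> K) :
  \prod_(j < n) \prod_(l < n | (j < l)%N) (if j == k then d l else if l == k then d j else 1)
  = \prod_(j | j != k) d j.
Proof.
rewrite (bigD1 k) //= eqxx big_mkcond.
rewrite [X in _ * X](_ : _ = \prod_(j | j != k) if (j < k)%N then d j else 1); last first.
  apply: eq_bigr => j jk; rewrite (negbTE jk); case: ltnP => [jk'|kj].
    by rewrite (bigD1 k) //= eqxx big1 ?mulr1 // => l /andP[_ /negbTE ->].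
  by apply: big1 => l jl; case: eqVneq => // e; move: jl; rewrite e ltnNge kj.
rewrite (bigD1 k) //= ltnn mul1r -big_split /=; apply: eq_bigr => j jk.
by case: ltngtP => [||/val_inj e]; rewrite ?mul1r ?mulr1 //; rewrite e eqxx in jk.
Qed.

(** Only pairs containing [k] change. In a pair [k < l] the prefactor [q] is absorbed by inverting
    both thetas, so either order of the pair contributes the ratio
    [th (q * z k / z l) / th (z k / z l)]. *)
Lemma delta_qshift n (k : 'I_n) (z : 'I_n -> K) : (forall j, z j != 0) ->
  delta (qshift z (unit_at k)) * \prod_(j | j != k) th (z k / z j) =
  delta z * \prod_(j | j != k) th (q * z k / z j).
Proof.
move=> z0; rewrite -2!prod_pairs_with /delta -!big_split /=; apply: eq_bigr => j _.
rewrite -!big_split /=; apply: eq_bigr => l jl; rewrite /qshift /unit_at.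
have jl' : j != l by apply: contraTneq jl => ->; rewrite ltnn.
have [jk|jk] := eqVneq j k.
  rewrite -jk eq_sym (negbTE jl') expr0 expr1 mulr1.
  rewrite [th (z l / z j)](th_div_swap thP) //.
  rewrite [th (z l / (z j * q))](th_div_swap thP) ?mulf_neq0 // [z j * q]mulrC.
  by field; rewrite q0 !z0.
have [lk|lk] := eqVneq l k; last by rewrite expr0 !mulr1.
by rewrite lk expr0 expr1 mulr1 [_ * q]mulrC mulrAC.
Qed.

Lemma delta_neq0 n (z : 'I_n -> K) : (forall j, z j != 0) ->
  (forall j k, j != k -> th (z k / z j) != 0) -> delta z != 0.
Proof.
move=> z0 zz; apply/prodf_neq0 => j _; apply/prodf_neq0 => k jk.
by rewrite mulf_neq0 // zz //; apply: contraTneq jk => ->; rewrite ltnn.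
Qed.

Section Weight.
Variables (n : nat) (z : 'I_n -> K).
Hypothesis z0 : forall j, z j != 0.

Lemma qshift_neq0 y j : qshift z y j != 0.
Proof. by rewrite mulf_neq0 ?expf_neq0. Qed.

Lemma nonresonant_le N N' : (N' <= N)%N -> nonresonant N z -> nonresonant N' z.
Proof. by move=> NN gz j k i iN; apply: gz; apply: leq_trans NN. Qed.

Lemma nonresonant_distinct N j k : nonresonant N z -> j != k -> th (z k / z j) != 0.
Proof. by move=> gz jk; have := gz j k 0%N isT; rewrite expr0 mulr1 jk; apply. Qed.

Lemma nonresonant_ratio N (y : 'I_n -> nat) j k : nonresonant N z -> j != k ->
  (y k <= N + y j)%N -> (y j <= N + y k)%N -> th (qshift z y k / qshift z y j) != 0.
Proof.
move=> gz jk kj jk'; rewrite /qshift.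
have qn0 i : q ^+ i != 0 by rewrite expf_neq0.
have [le|/ltnW le] := leqP (y j) (y k).
  rewrite -(subnK le) exprD.
  have -> : z k * (q ^+ (y k - y j) * q ^+ y j) / (z j * q ^+ y j)
     = z k * q ^+ (y k - y j) / z j by field; rewrite z0 qn0.
  by apply: gz; rewrite ?jk //; lia.
rewrite -(subnK le) exprD (th_div_neq0 thP) ?mulf_neq0 //.
have -> : z j * (q ^+ (y j - y k) * q ^+ y k) / (z k * q ^+ y k)
   = z j * q ^+ (y j - y k) / z k by field; rewrite z0 qn0.
by apply: gz; rewrite 1?eq_sym ?jk //; lia.
Qed.

(** The shift moves the exponent of a ratio by at most one, which costs one unit of the bound; the
    exponent [-1] is reached by inversion. *)
Lemma nonresonant_qshift N k : nonresonant N.+1 z -> nonresonant N (qshift z (unit_at k)).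
Proof.
move=> gz j l i iN; rewrite /qshift /unit_at.
case: (eqVneq l k) => [->|lk]; case: (eqVneq j k) => [->|jk] jl.
- have -> : z k * q ^+ 1 * q ^+ i / (z k * q ^+ 1) = z k * q ^+ i / z k.
    by field; rewrite q0 z0.
  by apply: gz => //; lia.
- have -> : z k * q ^+ 1 * q ^+ i / (z j * q ^+ 0) = z k * q ^+ i.+1 / z j.
    by rewrite [q ^+ i.+1]exprS; field; rewrite z0.
  by apply: gz; [lia|rewrite orbT].
- rewrite expr1 expr0 mulr1; case: i => [|i] in iN jl *; last first.
    rewrite exprSr mulrA -mulf_div divff // mulr1; apply: gz; [lia|by rewrite eq_sym lk].
  rewrite expr0 mulr1 (th_div_neq0 thP) ?mulf_neq0 //.
  by have := gz l k 1%N isT; rewrite expr1 orbT; apply.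
- by rewrite expr0 !mulr1; apply: gz; [lia|].
Qed.

Lemma nonresonant_poch N j k i : nonresonant N z -> (i <= N)%N -> poch (q * z k / z j) i != 0.
Proof.
move=> gz iN; rewrite /poch big_mkord; apply/prodf_neq0 => l _.
rewrite [q * _]mulrC -!mulrA [_ * q ^+ l]mulrC !mulrA -[z k * q * _]mulrA -exprS.
by apply: gz; [have := ltn_ord l; lia|rewrite orbT].
Qed.

Lemma nonresonant_pochs N y : nonresonant N z -> (forall j, (y j <= N)%N) -> pochs z y != 0.
Proof.
by move=> gz yN; apply/prodf_neq0 => j _; apply/prodf_neq0 => k _; apply: (@nonresonant_poch N).
Qed.

(** Only row and column [k] change: in the row the first factor of each symbol splits off, in the
    column [poch (q * a)] becomes [poch a]. The diagonal entry supplies the factor [j = k] of the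
    last product. *)
Lemma pochs_first k y :
  pochs z (incr k y) * \prod_(j | j != k) th (z j / z k) =
  pochs (qshift z (unit_at k)) y * \prod_(j | j != k) th (q * z k / z j)
    * \prod_j th (qshift z (incr k y) j / z k).
Proof.
pose d i := if i == k then 1 else th (z i / z k).
pose e i := if i == k then \prod_(j | j != k) th (q * z k / z j) else 1.
have -> : \prod_(j | j != k) th (z j / z k) = \prod_i d i.
  by rewrite [RHS](bigD1 k) //= /d eqxx mul1r; apply: eq_bigr => j /negbTE ->.
have -> : \prod_(j | j != k) th (q * z k / z j) = \prod_i e i.
  by rewrite [RHS](bigD1 k) //= /e eqxx [X in _ = _ * X]big1 ?mulr1 // => j /negbTE ->.
rewrite /pochs -!big_split /=; apply: eq_bigr => i _.
rewrite /d /e /qshift /incr /unit_at.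
have [->|ik] := eqVneq i k.
  rewrite [in LHS](bigD1 k) //= [in RHS](bigD1 k) //= eqxx.
  have -> : \prod_(j | j != k) poch (q * z k / z j) (1 + y k) =
     \prod_(j | j != k) th (q * z k / z j) *
     \prod_(j | j != k) poch (q * (z k * q ^+ true) / (z j * q ^+ (j == k))) (y k).
    rewrite -big_split /=; apply: eq_bigr => j /negbTE jk; rewrite jk expr0 mulr1 expr1.
    by rewrite poch_recl; congr (_ * poch _ _); ring.
  have -> : q * (z k * q ^+ true) / (z k * q ^+ true) = q by rewrite expr1; field; rewrite q0 z0.
  have -> : q * z k / z k = q by rewrite mulfK.
  have -> : z k * q ^+ (true + y k) / z k = q * q ^+ y k by rewrite exprS; field; rewrite z0.
  by rewrite poch_recr; ring.
rewrite (bigD1 k) //= [in RHS](bigD1 k) //= eqxx expr0 mulr1 expr1 mulr1.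
rewrite (eq_bigr (fun j => poch (q * z i / (z j * q ^+ (j == k))) (0 + y i))); last first.
  by move=> j /negbTE ->; rewrite expr0 mulr1.
rewrite add0n.
have -> : q * z i / (z k * q) = z i / z k by field; rewrite q0 z0.
have := poch_shift (z i / z k) (y i); rewrite mulrA mulrAC => ->.
by rewrite [z i * _ / _]mulrAC mulrAC.
Qed.

Lemma pochs_last k y :
  pochs z (incr k y) = pochs z y * \prod_j th (q * qshift z y k / z j).
Proof.
rewrite /pochs (bigD1 k) //= [in RHS](bigD1 k) //= /incr /unit_at eqxx.
rewrite mulrAC; congr (_ * _).
  rewrite -big_split; apply: eq_bigr => j _; rewrite poch_recr; congr (_ * th _).
  by rewrite /qshift; ring.
by apply: eq_bigr => j /negbTE ->.
Qed.

(** The bracket is the coefficient of the node [z k] in [bracket_first] at index [y + e_k]; this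
    match is what lets interpolation lower [N]. *)
Lemma weight_first N k y : nonresonant N z -> (forall j, (incr k y j <= N)%N) ->
  weight z (incr k y) * ((\prod_j th (qshift z (incr k y) j / z k))
     / (\prod_(j | j != k) th (z j / z k))) =
  weight (qshift z (unit_at k)) y / \prod_(j | j != k) th (z k / z j).
Proof.
move=> gz yN.
have N0 : (0 < N)%N by apply: leq_trans (yN k); rewrite /incr /unit_at eqxx.
case: N N0 => // N _ in gz yN *.
have gz' := nonresonant_qshift k gz.
have z'0 := qshift_neq0 (unit_at k).
have yN' j : (y j <= N.+1)%N by apply: leq_trans (yN j); rewrite /incr leq_addl.
have B0 : \prod_(j | j != k) th (z j / z k) != 0.
  by apply/prodf_neq0 => j jk; apply: (nonresonant_distinct gz); rewrite eq_sym.
have C0 : \prod_(j | j != k) th (z k / z j) != 0.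
  by apply/prodf_neq0 => j jk; apply: (nonresonant_distinct gz).
have E0 : \prod_(j | j != k) th (q * z k / z j) != 0.
  apply/prodf_neq0 => j jk; have := gz j k 1%N isT.
  by rewrite expr1 [z k * q]mulrC orbT; apply.
have A0 : \prod_j th (qshift z (incr k y) j / z k) != 0.
  apply/prodf_neq0 => j _; apply: gz => //; rewrite /incr /unit_at eq_sym.
  by case: eqVneq => // ->; rewrite eqxx.
have d0 : delta z != 0 by apply: delta_neq0 => // *; apply: (nonresonant_distinct gz).
have d'0 : delta (qshift z (unit_at k)) != 0.
  apply: delta_neq0 => // i j ij; apply: (nonresonant_ratio gz) => //.
    by rewrite /unit_at; case: eqP => //; lia.
  by rewrite /unit_at; case: eqP => //; lia.
have D0 : pochs z (incr k y) != 0 by apply: (nonresonant_pochs gz).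
have := pochs_first k y; have := delta_qshift k z0.
rewrite /weight qshift_incr => ed eD.
have D'0 : pochs (qshift z (unit_at k)) y != 0.
  by apply: contraNneq (mulf_neq0 D0 B0) => e; rewrite eD e !mul0r.
rewrite -(mulfK C0 (delta (qshift z _))) ed -(mulfK B0 (pochs z (incr k y))) eD.
by rewrite qshift_incr in A0 *; field; rewrite A0 B0 C0 D'0 E0 d0.
Qed.

(** The bracket is the coefficient in [bracket_last] at index [y + e_k]: there the node of index [k]
    is [q * qshift z y k] and the other nodes are those of [y]. *)
Lemma weight_last N k y : nonresonant N z -> (forall j, (incr k y j <= N)%N) ->
  weight z (incr k y) * ((\prod_j th (q * qshift z y k / z j))
     / (\prod_(j | j != k) th (q * qshift z y k / qshift z y j))) =
  weight z y / \prod_(j | j != k) th (qshift z y k / qshift z y j).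
Proof.
move=> gz yN.
have N0 : (0 < N)%N by apply: leq_trans (yN k); rewrite /incr /unit_at eqxx.
have yN' j : (y j <= N)%N by apply: leq_trans (yN j); rewrite /incr leq_addl.
have yk : (y k < N)%N by have := yN k; rewrite /incr /unit_at eqxx.
have B0 : \prod_(j | j != k) th (q * qshift z y k / qshift z y j) != 0.
  apply/prodf_neq0 => j jk.
  have -> : q * qshift z y k / qshift z y j =
            qshift z (incr k y) k / qshift z (incr k y) j.
    rewrite /qshift /incr /unit_at eqxx (negbTE jk) add0n exprS.
    by rewrite mulrCA mulrA.
  by apply: (nonresonant_ratio gz) => //; apply: leq_trans (leq_addr _ _).
have C0 : \prod_(j | j != k) th (qshift z y k / qshift z y j) != 0.
  apply/prodf_neq0 => j jk.
  by apply: (nonresonant_ratio gz) => //; apply: leq_trans (leq_addr _ _).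
have A0 : \prod_j th (q * qshift z y k / z j) != 0.
  apply/prodf_neq0 => j _; rewrite /qshift mulrCA -exprS; apply: gz => //.
  by rewrite orbT.
have d0 : delta z != 0 by apply: delta_neq0 => // *; apply: (nonresonant_distinct gz).
have D0 : pochs z y != 0 by apply: (nonresonant_pochs gz).
have := delta_qshift k (qshift_neq0 y).
rewrite /weight qshift_incr_last pochs_last => ed.
have -> : delta (qshift (qshift z y) (unit_at k)) = delta (qshift z y) *
   (\prod_(j | j != k) th (q * qshift z y k / qshift z y j)) /
   (\prod_(j | j != k) th (qshift z y k / qshift z y j)) by rewrite -ed mulfK.
by field; rewrite B0 C0 A0 d0 D0.
Qed.

Lemma onebody_first g k y :
  onebody g z (incr k y) = g (z k) * onebody g (qshift z (unit_at k)) y.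
Proof.
rewrite /onebody (bigD1 k) //= [in RHS](bigD1 k) //= mulrA /incr /unit_at /qshift eqxx.
congr (_ * _).
  rewrite big_nat_recl // expr0 mulr1; congr (_ * _); apply: eq_bigr => i _.
  by rewrite expr1 exprS mulrA.
by apply: eq_bigr => j /negbTE jk; rewrite eq_sym in jk; rewrite eq_sym jk expr0 mulr1.
Qed.

Lemma onebody_last g k y :
  onebody g z (incr k y) = onebody g z y * g (qshift z y k).
Proof.
rewrite /onebody (bigD1 k) //= [in RHS](bigD1 k) //= mulrAC /incr /unit_at eqxx.
congr (_ * _); first by rewrite big_nat_recr.
by apply: eq_bigr => j /negbTE ->.
Qed.

Lemma onebodyM g h y : onebody (fun t => g t * h t) z y = onebody g z y * onebody h z y.
Proof. by rewrite -big_split; apply: eq_bigr => k _; rewrite -big_split. Qed.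

End Weight.

Lemma prod_qshift n (z : 'I_n -> K) y :
  \prod_k qshift z y k = (\prod_k z k) * q ^+ (\sum_k y k)%N.
Proof. by rewrite big_split /= prodrXr. Qed.

Lemma big_nat_pred (F : nat -> K) m : (0 < m)%N ->
  \prod_(0 <= i < m) F i = F 0%N * \prod_(0 <= i < m.-1) F i.+1.
Proof. by case: m => // m _; rewrite big_nat_recl. Qed.

Lemma big_nat_predr (F : nat -> K) m : (0 < m)%N ->
  \prod_(0 <= i < m) F i = (\prod_(0 <= i < m.-1) F i) * F m.-1.
Proof. by case: m => // m _; rewrite big_nat_recr. Qed.

(* Only the nodes with [0 < y k] are interpolated, so that no genericity of [b] is needed. *)
Lemma bracket_first n (z : 'I_n -> K) (y : 'I_n -> nat) (b : K) :
  (forall j, z j != 0) -> (forall j k, j != k -> th (z j / z k) != 0) -> b != 0 ->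
  \sum_(k | (0 < y k)%N)
     (\prod_j th (qshift z y j / z k)) / (\prod_(j | j != k) th (z j / z k)) *
     (th (q ^+ (\sum_k y k) * b * z k) *
      onebody (fun t => th (b * t)) (qshift z (unit_at k)) (decr k y)) =
  th (q ^+ (\sum_k y k)) * onebody (fun t => th (q * b * t)) z y.
Proof.
move=> z0 zz b0; pose S := [set k | (0 < y k)%N].
(* The blocks of [th (q * b * t)] and of [th (b * t)] overlap in [R j]. They differ in the end
   factor [th (b * z j * q ^+ y j)] against the initial [th (b * z j)]; these are the factors that
   interpolation at [s = 1 / b] relates. *)
pose R j := \prod_(0 <= i < (y j).-1) th (b * z j * q ^+ i.+1).
have c0 k : qshift z y k != 0 by apply: qshift_neq0.
have cz k : k \notin S -> qshift z y k = z k.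
  by rewrite inE lt0n negbK /qshift => /eqP ->; rewrite expr0 mulr1.
have b'0 : b^-1 != 0 by rewrite invr_eq0.
have := th_interpolation_sub b'0 z0 c0 zz cz.
have Z0 : \prod_k z k != 0 by apply/prodf_neq0.
rewrite prod_qshift [_ * q ^+ _]mulrC mulfK // => LG.
have -> : onebody (fun t => th (q * b * t)) z y =
    (\prod_(j in S) R j) * \prod_(k in S) th (qshift z y k / b^-1).
  rewrite -big_split /= /onebody (bigID (mem S)) /= [X in _ * X]big1 ?mulr1; last first.
    by move=> j; rewrite inE lt0n negbK => /eqP ->; rewrite big_nil.
  apply: eq_bigr => j; rewrite inE => yj; rewrite big_nat_predr // invrK.
  congr (_ * th _); first by apply: eq_bigr => i _; rewrite exprS; congr (th _); ring.
  by rewrite /qshift -[in RHS](prednK yj) exprS; ring.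
rewrite mulrCA -LG mulr_sumr; apply: eq_big => [k|k yk]; first by rewrite inE.
have Sk : k \in S by rewrite inE.
have -> : onebody (fun t => th (b * t)) (qshift z (unit_at k)) (decr k y) =
    (\prod_(j in S) R j) * \prod_(j in S :\ k) th (z j / b^-1).
  rewrite (big_setD1 _ Sk) /= -mulrA -big_split /= /onebody (bigD1 k) //=.
  congr (_ * _).
    rewrite /decr /unit_at eqxx subn1; apply: eq_bigr => i _.
    by rewrite /qshift eqxx expr1 exprS; congr (th _); ring.
  rewrite (bigID (mem S)) /= [X in _ * X]big1 ?mulr1; last first.
    move=> j /andP[_]; rewrite inE lt0n negbK /decr => /eqP ->.
    by rewrite sub0n big_nil.
  apply: eq_big => [j|j /andP[jk]]; first by rewrite !inE.
  rewrite inE => yj; rewrite /decr /unit_at /qshift (negbTE jk) subn0 big_nat_pred //.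
  rewrite !expr0 !mulr1 invrK mulrC [z j * b]mulrC; congr (_ * _).
  by apply: eq_bigr => i _; rewrite mulrA.
have -> : q ^+ (\sum_k y k) * z k / b^-1 = q ^+ (\sum_k y k) * b * z k.
  by rewrite invrK mulrAC.
by ring.
Qed.

(** Interpolation at inverses: nodes [1 / (w j * q ^+ y j)], parameters [1 / w j] and
    [s = 1 / (q * b)], so that again [t] is [q] to the sum of [y]. *)
Lemma bracket_last n (w : 'I_n -> K) (y : 'I_n -> nat) (b : K) :
  (forall j, w j != 0) ->
  (forall j k, j != k -> th (qshift w y j / qshift w y k) != 0) -> b != 0 ->
  \sum_(k | (0 < y k)%N)
     (\prod_j th (qshift w y k / w j)) /
     (\prod_(j | j != k) th (qshift w y k / qshift w y j)) *
     (th (qshift w y k / (q ^+ (\sum_k y k).+1 * b)) *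
      onebody (fun t => th (t / b)) w (decr k y)) =
  th (q ^+ (\sum_k y k)) * onebody (fun t => th (t / (q * b))) w y.
Proof.
move=> w0 ww b0; pose S := [set k | (0 < y k)%N].
set N := (\sum_k y k)%N.
pose R j := \prod_(0 <= i < (y j).-1) th (w j * q ^+ i / b).
pose x k := (qshift w y k)^-1; pose c k := (w k)^-1.
have qw0 k : qshift w y k != 0 by apply: qshift_neq0.
have x0 k : x k != 0 by rewrite invr_eq0.
have c0 k : c k != 0 by rewrite invr_eq0.
have cx k : k \notin S -> c k = x k.
  by rewrite inE lt0n negbK /x /c /qshift => /eqP ->; rewrite expr0 mulr1.
have xx j k : j != k -> th (x j / x k) != 0.
  by move=> jk; rewrite /x invrK mulrC ww // eq_sym.
have qb0 : (q * b)^-1 != 0 by rewrite invr_eq0 mulf_neq0.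
have W0 : \prod_k w k != 0 by apply/prodf_neq0.
have qN0 m : q ^+ m != 0 by rewrite expf_neq0.
have := th_interpolation_sub qb0 x0 c0 xx cx.
have -> : \prod_k c k / \prod_k x k = q ^+ N.
  by rewrite /c /x !prodfV prod_qshift -/N; field; rewrite W0 qN0 oner_eq0.
move=> LG.
(* The monomials produced by inverting the thetas back; their product is the same for every [k] and
   on the right side, so it cancels. *)
pose r := q ^+ N * \prod_(j in S) - (q * b * x j).
have rE : \prod_(k in S) th (c k / (q * b)^-1) =
          r * \prod_(k in S) th (w k / (q * b)).
  have -> : r = \prod_(k in S) - (q * b / w k).
    rewrite /r.
    have -> : q ^+ N = \prod_(k in S) q ^+ y k.
      rewrite prodrXr; congr (_ ^+ _); rewrite /N (bigID (mem S)) /=.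
      rewrite [X in (_ + X)%N]big1 ?addn0 // => k.
      by rewrite inE lt0n negbK => /eqP.
    rewrite -big_split /=; apply: eq_bigr => k _; rewrite /x /qshift.
    by field; rewrite w0 qN0.
  rewrite -big_split /=; apply: eq_bigr => k _.
  by rewrite /c invrK mulrC (th_div_swap thP) ?mulf_neq0 ?mulNr.
have r0 : r != 0.
  by rewrite mulf_neq0 //; apply/prodf_neq0 => k _; rewrite oppr_eq0 !mulf_neq0.
have -> : onebody (fun t => th (t / (q * b))) w y =
    (\prod_(j in S) R j) * \prod_(k in S) th (w k / (q * b)).
  rewrite -big_split /= /onebody (bigID (mem S)) /= [X in _ * X]big1 ?mulr1; last first.
    by move=> j; rewrite inE lt0n negbK => /eqP ->; rewrite big_nil.
  apply: eq_bigr => j; rewrite inE => yj; rewrite big_nat_pred // expr0 mulr1 mulrC.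
  congr (_ * _); apply: eq_bigr => i _; rewrite exprS; congr (th _).
  by field; rewrite q0 b0.
apply: (mulfI r0).
have -> : r * (th (q ^+ N) * (\prod_(j in S) R j * \prod_(k in S) th (w k / (q * b))))
   = (\prod_(j in S) R j) * (th (q ^+ N) * (r * \prod_(k in S) th (w k / (q * b)))) by ring.
rewrite -rE -LG !mulr_sumr; apply: eq_big => [k|k yk]; first by rewrite inE.
have Sk : k \in S by rewrite inE.
have -> : onebody (fun t => th (t / b)) w (decr k y) =
    (\prod_(j in S) R j) * \prod_(j in S :\ k) th (qshift w y j / (q * b)).
  rewrite (big_setD1 _ Sk) /= -mulrA -big_split /= /onebody (bigD1 k) //=.
  congr (_ * _); first by rewrite /decr /unit_at eqxx subn1.
  rewrite (bigID (mem S)) /= [X in _ * X]big1 ?mulr1; last first.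
    move=> j /andP[_]; rewrite inE lt0n negbK /decr => /eqP ->.
    by rewrite sub0n big_nil.
  apply: eq_big => [j|j /andP[jk]]; first by rewrite !inE.
  rewrite inE => yj; rewrite /decr /unit_at /qshift (negbTE jk) subn0 big_nat_predr //.
  congr (_ * th _); rewrite -[in RHS](prednK yj) exprS.
  by field; rewrite q0 b0.
have -> : \prod_(j in S :\ k) th (x j / (q * b)^-1) =
    (\prod_(j in S :\ k) - (q * b * x j)) * \prod_(j in S :\ k) th (qshift w y j / (q * b)).
  rewrite -big_split /=; apply: eq_bigr => j _.
  by rewrite /x invrK mulrC (th_div_swap thP) ?mulf_neq0 ?mulNr.
have -> : q ^+ N * x k / (q * b)^-1 = (q ^+ N.+1 * b) / qshift w y k.
  by rewrite invrK exprS /x; ring.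
rewrite [th (_ * b / _)](th_div_swap thP) ?mulf_neq0 //.
have -> : r = q ^+ N * (- (q * b * x k) * \prod_(j in S :\ k) - (q * b * x j)).
  by rewrite /r (big_setD1 _ Sk).
have -> : \prod_j th (c j / x k) = \prod_j th (qshift w y k / w j).
  by apply: eq_bigr => j _; rewrite /c /x invrK mulrC.
have -> : \prod_(j | j != k) th (x j / x k) =
          \prod_(j | j != k) th (qshift w y k / qshift w y j).
  by apply: eq_bigr => j _; rewrite /x invrK mulrC.
have P0 : \prod_(j | j != k) th (qshift w y k / qshift w y j) != 0.
  by apply/prodf_neq0 => j jk; rewrite ww // eq_sym.
by rewrite /x exprS; field; rewrite P0 qw0.
Qed.

(** * Sums over compositions *)

Section Compositions.
Variables (B n : nat).

(* The bound [B] on the parts is independent of [N], so that sums for different [N]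
   range over the same type. *)
Definition composition_sum N (f : ('I_n -> nat) -> K) :=
  \sum_(y : {ffun 'I_n -> 'I_B.+1} | (\sum_k y k == N)%N) f (fun k => y k).

Lemma eq_composition_sum N f g :
  (forall y, (\sum_k y k)%N = N -> f y = g y) -> composition_sum N f = composition_sum N g.
Proof. by move=> fg; apply: eq_bigr => y /eqP; apply: fg. Qed.

Lemma composition_sumZ N a f : composition_sum N (fun y => a * f y) = a * composition_sum N f.
Proof. by rewrite /composition_sum mulr_sumr. Qed.

Lemma sum_unit_at (k : 'I_n) : (\sum_j unit_at k j = 1)%N.
Proof. by rewrite (bigD1 k) //= /unit_at eqxx big1 // => j /negbTE ->. Qed.

Lemma sum_incr k (y : 'I_n -> nat) : (\sum_j incr k y j = (\sum_j y j).+1)%N.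
Proof. by rewrite big_split /= sum_unit_at. Qed.

(** Both sides run over a composition [y'] of [N] with a position [k], through [y = y' + e_k];
    [N < B] leaves room for the raised entry. *)
Lemma composition_sum_step N (G : 'I_n -> ('I_n -> nat) -> K) : (N < B)%N ->
  composition_sum N.+1 (fun y => \sum_(k | (0 < y k)%N) G k (decr k y)) =
  \sum_k composition_sum N (G k).
Proof.
move=> NB; rewrite /composition_sum (exchange_big_dep predT) //=; apply: eq_bigr => k _.
pose up (y : {ffun 'I_n -> 'I_B.+1}) : {ffun 'I_n -> 'I_B.+1} :=
  [ffun j => inord (incr k (fun j => y j) j)].
pose dn (y : {ffun 'I_n -> 'I_B.+1}) : {ffun 'I_n -> 'I_B.+1} :=
  [ffun j => inord (decr k (fun j => y j) j)].
have dnE (y : {ffun 'I_n -> 'I_B.+1}) : (fun j => dn y j : nat) = decr k (fun j => y j).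
  by apply/funext => j; rewrite ffunE inordK // /decr (leq_ltn_trans (leq_subr _ _)).
have upE (y : {ffun 'I_n -> 'I_B.+1}) : (\sum_j y j)%N = N ->
    (fun j => up y j : nat) = incr k (fun j => y j).
  move=> yN; apply/funext => j; rewrite ffunE inordK // ltnS; apply: leq_trans NB.
  rewrite -yN -(sum_incr k) (bigD1 j) //= leq_addr //.
rewrite (reindex_onto up dn) /=; last first.
  move=> y /andP[/eqP yN yk]; apply/ffunP => j; apply/val_inj; rewrite ffunE /= dnE.
  by rewrite incrK // inordK.
apply: eq_big => [y|y].
  apply/andP/eqP => [[/andP[/eqP yN yk] /eqP <-]|yN].
    apply: succn_inj; rewrite -yN -(sum_incr k); apply: eq_bigr => j _.
    by rewrite dnE incrK.
  have uE := upE _ yN; have uEj j : up y j = incr k (fun j => y j) j :> nat by rewrite -uE.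
  split; last first.
    apply/eqP/ffunP => j; apply/val_inj; rewrite /= -[LHS]/((fun j => dn (up y) j : nat) j).
    by rewrite dnE /decr uEj /incr addKn.
  rewrite uEj /incr /unit_at eqxx andbT.
  rewrite (eq_bigr (incr k (fun j => y j))) => [|j _]; last exact: uEj.
  by rewrite sum_incr yN.
by move=> /andP[_ /eqP e]; rewrite -dnE e.
Qed.

End Compositions.

(** * Recursions in [N] and the inductive proof *)

Definition duality_sum B N n (z : 'I_n -> K) (g : K -> K) :=
  composition_sum B N (fun y => weight z y * onebody g z y).

Lemma le_sum_term n (y : 'I_n -> nat) j : (y j <= \sum_k y k)%N.
Proof. by rewrite (bigD1 j) //= leq_addr. Qed.

Lemma duality_sum_first B N n (z : 'I_n -> K) g b : (N < B)%N -> b != 0 ->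
  (forall j, z j != 0) -> nonresonant N.+1 z ->
  th (q ^+ N.+1) * duality_sum B N.+1 z (fun t => g t * th (q * b * t)) =
  \sum_k g (z k) * th (q ^+ N.+1 * b * z k) / (\prod_(j | j != k) th (z k / z j)) *
    duality_sum B N (qshift z (unit_at k)) (fun t => g t * th (b * t)).
Proof.
move=> NB b0 z0 gz; rewrite /duality_sum -composition_sumZ.
under [RHS]eq_bigr do rewrite -composition_sumZ.
rewrite -composition_sum_step //; apply: eq_composition_sum => y yN.
rewrite onebodyM mulrCA [th _ * _]mulrCA -{1}yN -bracket_first //; last first.
  by move=> j k jk; apply: (nonresonant_distinct gz); rewrite eq_sym.
rewrite yN !mulr_sumr; apply: eq_bigr => k yk.
have yE := incrK yk.
have yN' j : (incr k (decr k y) j <= N.+1)%N by rewrite yE -yN le_sum_term.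
have := weight_first z0 gz yN'; rewrite yE => W.
have := onebody_first z g k (decr k y); rewrite yE => ->.
rewrite onebodyM.
set A := (\prod_j _) / _ in W *; set w := weight z y in W *.
set O := onebody g _ _; set O' := onebody (fun t => th (b * t)) _ _.
set P := \prod_(j | j != k) th (z k / z j) in W *.
have -> : g (z k) * th (q ^+ N.+1 * b * z k) / P *
    (weight (qshift z (unit_at k)) (decr k y) * (O * O')) =
    weight (qshift z (unit_at k)) (decr k y) / P *
    (g (z k) * th (q ^+ N.+1 * b * z k) * O * O') by ring.
by rewrite -W; ring.
Qed.

Lemma duality_sum_last B N n (w : 'I_n -> K) h b : (N < B)%N -> b != 0 ->
  (forall j, w j != 0) -> nonresonant N.+1 w ->
  th (q ^+ N.+1) * duality_sum B N.+1 w (fun t => h t * th (t / (q * b))) =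
  composition_sum B N (fun y => weight w y * onebody (fun t => h t * th (t / b)) w y *
    \sum_k h (qshift w y k) * th (qshift w y k / (q ^+ N.+1 * b)) /
       (\prod_(j | j != k) th (qshift w y k / qshift w y j))).
Proof.
move=> NB b0 w0 gw; rewrite /duality_sum -composition_sumZ.
pose G k y := weight w y * onebody (fun t => h t * th (t / b)) w y *
  (h (qshift w y k) * th (qshift w y k / (q ^+ N.+1 * b)) /
       (\prod_(j | j != k) th (qshift w y k / qshift w y j))).
transitivity (\sum_k composition_sum B N (G k)); last first.
  by rewrite /composition_sum exchange_big; apply: eq_bigr => y _; rewrite mulr_sumr.
rewrite -composition_sum_step //; apply: eq_composition_sum => y yN.
have y_le j : (y j <= N.+1)%N by rewrite -yN le_sum_term.
rewrite onebodyM mulrCA [th _ * _]mulrCA -{1}yN -bracket_last //; last first.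
  move=> j k jk; apply: (nonresonant_ratio w0 gw); rewrite 1?eq_sym //;
    by apply: leq_trans (y_le _) (leq_addr _ _).
rewrite yN !mulr_sumr; apply: eq_bigr => k yk.
have yE := incrK yk.
have yN' j : (incr k (decr k y) j <= N.+1)%N by rewrite yE.
have := weight_last w0 gw yN'.
have := onebody_last w h k (decr k y); rewrite yE => ->.
rewrite /G onebodyM.
have qE : q * qshift w (decr k y) k = qshift w y k.
  by rewrite /qshift /decr /unit_at eqxx mulrCA -exprS subn1 prednK.
have eqN j : j != k -> qshift w (decr k y) j = qshift w y j.
  by move=> /negbTE jk; rewrite /qshift /decr /unit_at jk subn0.
rewrite qE.
rewrite [\prod_(j | j != k) th (qshift w y k / qshift w (decr k y) j)](eq_bigr
   (fun j => th (qshift w y k / qshift w y j))); last by move=> j /eqN ->.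
set Z := qshift w (decr k y) k.
have -> : qshift w y k / (q ^+ N.+2 * b) = Z / (q ^+ N.+1 * b).
  by rewrite -qE -/Z exprS; field; rewrite q0 b0 expf_neq0.
set A := (\prod_j _) / _; set P := \prod_(j | j != k) _ => W.
have -> : weight w (decr k y) *
    (onebody h w (decr k y) * onebody (fun t => th (t / b)) w (decr k y)) *
    (h Z * th (Z / (q ^+ N.+1 * b)) / P) = weight w (decr k y) / P *
    (onebody h w (decr k y) * onebody (fun t => th (t / b)) w (decr k y) *
    (h Z * th (Z / (q ^+ N.+1 * b)))) by ring.
by rewrite -W; ring.
Qed.

Lemma composition_sum0 B n f : composition_sum B 0 f = f (fun _ : 'I_n => 0%N).
Proof.
rewrite /composition_sum (big_pred1 [ffun => ord0]) => [|y].
  by congr f; apply/funext => j; rewrite ffunE.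
apply/eqP/eqP => [y0|->]; last by rewrite big1 // => j _; rewrite ffunE.
apply/ffunP => j; apply/val_inj; rewrite ffunE /=.
by have := le_sum_term (fun j => y j) j; rewrite y0 leqn0 => /eqP.
Qed.

Lemma duality_sum0 B n (z : 'I_n -> K) g :
  (forall j, z j != 0) -> nonresonant 0 z -> duality_sum B 0 z g = 1.
Proof.
move=> z0 gz; rewrite /duality_sum composition_sum0 /weight /onebody /pochs.
have -> : qshift z (fun=> 0%N) = z by apply/funext => j; rewrite /qshift mulr1.
rewrite !big1 => [|k _|k _].
- by rewrite invr1 !mulr1 divff // delta_neq0 // => *; apply: (nonresonant_distinct gz).
- by rewrite big_nil.
- by rewrite big1 // => j _; rewrite /poch big_nil.
Qed.

(** Replacing [z k] by [q * z k] multiplies the dual one-body function by [f t / f (q * t)] with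
    [f t = th (t * z k)]; along a block only the two ends survive. *)
Lemma onebody_telescope N n (w : 'I_n -> K) (f : K -> K) y :
  (forall i l, (l <= N)%N -> f (w i * q ^+ l) != 0) -> (forall i, (y i <= N)%N) ->
  onebody (fun t => f t / f (q * t)) w y = \prod_i (f (w i) / f (qshift w y i)).
Proof.
move=> f0 yN; apply: eq_bigr => i _; rewrite /qshift.
elim: (y i) (yN i) => [_|l IH lN].
  by rewrite big_nil mulr1 divff //; have := f0 i 0%N isT; rewrite mulr1.
rewrite big_nat_recr //= IH 1?ltnW // [q * _]mulrCA -exprS.
have := f0 i l (ltnW lN); have := f0 i _ lN => n1 n2.
by field; rewrite n1 n2.
Qed.

Definition primal_factor (I : finType) (cs : seq K) (w : I -> K) t :=
  (\prod_(c <- cs) th (c * t)) / \prod_i th (w i * t).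
Definition dual_factor (I : finType) (cs : seq K) (z : I -> K) t :=
  (\prod_(c <- cs) th (t / c)) / \prod_k th (t * z k).

Lemma duality_sum_dual B N m n (z : 'I_n -> K) (w : 'I_m -> K) (cs : seq K) :
  (N <= B)%N -> (0 < n)%N -> size cs = (m + n)%N ->
  (forall j, z j != 0) -> (forall j, w j != 0) -> all (fun c => c != 0) cs ->
  nonresonant N z -> nonresonant N w ->
  (forall i k l, (l < N)%N -> th (w i * q ^+ l * z k) != 0) ->
  \prod_i w i = \prod_k z k * \prod_(c <- cs) c ->
  duality_sum B N z (primal_factor cs w) = duality_sum B N w (dual_factor cs z).
Proof.
move=> + n0 + + w0; elim: N z cs => [|N IH] z cs NB szc z0 c0 gz gw wz eqp.
  by rewrite !duality_sum0.
case: cs szc c0 eqp => [|a cs] /= szc; first by lia.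
case/andP=> a0 c0; rewrite big_cons => eqp.
(* Lowering [a] to [b] compensates the shift of one [z k] by [q], so the balancing condition
   persists with [w] fixed. *)
pose b := a / q; have aE : a = q * b by rewrite /b mulrC divfK.
have b0 : b != 0 by rewrite mulf_neq0 ?invr_eq0.
have qN0 l : q ^+ l != 0 by rewrite expf_neq0.
have thqN : th (q ^+ N.+1) != 0.
  have := gz (Ordinal n0) (Ordinal n0) N.+1 (leqnn _).
  by rewrite orbT [z _ * _]mulrC mulfK //; apply.
apply: (mulfI thqN).
pose g := primal_factor cs w; pose h := dual_factor cs z.
have -> : primal_factor (a :: cs) w = (fun t => g t * th (q * b * t)).
  by apply/funext => t; rewrite /g /primal_factor big_cons -aE; ring.
have -> : dual_factor (a :: cs) z = (fun t => h t * th (t / (q * b))).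
  by apply/funext => t; rewrite /h /dual_factor big_cons -aE; ring.
rewrite duality_sum_first // duality_sum_last //.
pose C k := g (z k) * th (q ^+ N.+1 * b * z k) / \prod_(j | j != k) th (z k / z j).
transitivity (\sum_k composition_sum B N (fun y =>
    weight w y * onebody (fun t => h t * th (t / b)) w y *
    (C k * \prod_i (th (w i * z k) / th (qshift w y i * z k))))).
  apply: eq_bigr => k _.
  have -> : (fun t => g t * th (b * t)) = primal_factor (b :: cs) w.
    by apply/funext => t; rewrite /g /primal_factor big_cons; ring.
  rewrite (IH _ (b :: cs)) //=; first last.
  - by rewrite prod_qshift sum_unit_at big_cons eqp aE; ring.
  - move=> i j l lN; rewrite /qshift /unit_at.
    case: (eqVneq j k) => _; last by rewrite expr0 mulr1 wz // ltnW.
    have := wz i j l.+1 lN; congr (th _ != 0); rewrite expr1 exprS; ring.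
  - exact: nonresonant_le gw.
  - exact: nonresonant_qshift.
  - by rewrite b0.
  - exact: qshift_neq0.
  - by lia.
  rewrite /duality_sum -composition_sumZ; apply: eq_composition_sum => y yN.
  have -> : onebody (dual_factor (b :: cs) (qshift z (unit_at k))) w y =
     onebody (fun t => (h t * th (t / b)) * (th (t * z k) / th (q * t * z k))) w y.
    apply: eq_bigr => i _; rewrite !big_mkord; apply: eq_bigr => l _.
    have lN : (l < N.+1)%N.
      by have := ltn_ord l; have := le_sum_term y i; rewrite yN; lia.
    have := wz i k l lN; set t := w i * _ => tz.
    rewrite /dual_factor /h /dual_factor big_cons (bigD1 k) //= [in RHS](bigD1 k) //=.
    rewrite (eq_bigr (fun j => th (t * z j))); last first.
      by move=> j /negbTE jk; rewrite /qshift /unit_at jk expr0 mulr1.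
    rewrite /qshift /unit_at eqxx expr1.
    have -> : t * (z k * q) = q * t * z k by ring.
    rewrite !invfM; move: (\prod_(j | j != k) _)^-1 (th (q * t * z k))^-1 => u v.
    by field.
  rewrite onebodyM (@onebody_telescope N m w (fun t => th (t * z k))) //.
  - by rewrite /C; ring.
  - by move=> i l lN; apply: wz.
  - by move=> i; rewrite -yN le_sum_term.
(* For fixed [y] the telescoped quotient has replaced [w i] by [w i * q ^+ y i] in the denominators,
   which leaves an instance of [th_duality1], balanced because [y] has sum [N]. *)
rewrite /composition_sum exchange_big /=; apply: eq_bigr => y /eqP yN.
have y_le j : (y j <= N)%N by rewrite -yN; apply: le_sum_term.
rewrite -mulr_sumr; congr (_ * _).
set Z := qshift w _.
have Z0 i : Z i != 0 by apply: qshift_neq0.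
have zz j k : j != k -> th (z k / z j) != 0 by apply: (nonresonant_distinct gz).
have ZZ j k : j != k -> th (Z k / Z j) != 0.
  by move=> jk; apply: (nonresonant_ratio w0 gw) => //; apply: leq_trans (leq_addr _ _);
    apply: leqW.
have Zz i k : th (Z i * z k) != 0 by apply: wz; rewrite ltnS.
have e0 : all (fun c => c != 0) ((q ^+ N.+1 * b) :: cs) by rewrite /= mulf_neq0.
have szc' : size ((q ^+ N.+1 * b) :: cs) = (#|'I_m| + #|'I_n|)%N by rewrite !card_ord.
have eqp' : \prod_i Z i = \prod_k z k * \prod_(c <- (q ^+ N.+1 * b) :: cs) c.
  by rewrite prod_qshift eqp yN aE big_cons exprS; ring.
have := th_duality1 thP szc' z0 Z0 e0 zz ZZ Zz eqp' => D.
apply: etrans (etrans _ D) _; apply: eq_bigr => k _; rewrite big_cons.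
  rewrite /C /g /primal_factor prodf_div.
  have P0 : \prod_(j | j != k) th (z k / z j) != 0 by apply/prodf_neq0 => j; apply: zz.
  have P1 : \prod_i th (w i * z k) != 0.
    by apply/prodf_neq0 => i _; have := wz i k 0%N isT; rewrite mulr1.
  have P2 : \prod_i th (Z i * z k) != 0 by apply/prodf_neq0 => i _.
  by field; rewrite P0 P1 P2.
rewrite /h /dual_factor; have P0 : \prod_(j | j != k) th (Z k / Z j) != 0.
  by apply/prodf_neq0 => j; apply: ZZ.
have P2 : \prod_i th (Z k * z i) != 0 by apply/prodf_neq0 => i _.
by field; rewrite P0 P2.
Qed.

End Duality.

(** Exponent [0] is covered by the factors of [delta], with inversion for reversed pairs; exponents
    from [1] to [N] are the factors of the longest Pochhammer symbol. *)
Lemma nonresonant_of_neq0 (K : fieldType) (th : K -> K) (q : K) N n (z : 'I_n -> K) :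
  theta_like th -> q != 0 -> (forall j, z j != 0) -> delta th z != 0 ->
  ((0 < N)%N -> forall j k, poch th q (q * z k / z j) N != 0) -> nonresonant th q N z.
Proof.
move=> thP q0 z0 dz hz j k [|i] iN /=.
  rewrite orbF mulr1 => jk.
  have lt (j' k' : 'I_n) : (j' < k')%N -> th (z k' / z j') != 0.
    move=> jk'; apply: contraNneq dz => t0; apply/eqP; rewrite /delta.
    by rewrite (bigD1 j') //= [X in X * _](bigD1 k') //= t0 mulr0 !mul0r.
  have [jk'|kj|e] := ltngtP j k; first exact: lt.
    by rewrite (th_div_neq0 thP) // lt.
  by case/eqP: jk; apply: val_inj.
move=> _; have N0 : (0 < N)%N by apply: leq_trans iN.
have := hz N0 j k; rewrite /poch big_mkord => /prodf_neq0/(_ (Ordinal iN) isT).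
by congr (th _ != 0); rewrite /= exprS; ring.
Qed.

(** * Convergence at a geometric rate *)

Section Modulus.
Variable R : realType.
Implicit Types x y : R[i].

(** The norm of [R[i]] takes its values in [R[i]]; [nm] is the same modulus in the real field, where
    the estimates are made. *)
Definition nm x : R := complex.Re `|x|.

Lemma nmE x : `|x| = (nm x)%:C.
Proof. by rewrite /nm normc_def. Qed.

Lemma nm_ge0 x : 0 <= nm x.
Proof. by rewrite -lecR -nmE rmorph0 normr_ge0. Qed.

Lemma nmM x y : nm (x * y) = nm x * nm y.
Proof. by apply: (@complexI R); rewrite rmorphM -!nmE normrM. Qed.

Lemma nmD x y : nm (x + y) <= nm x + nm y.
Proof. by rewrite -lecR rmorphD -!nmE ler_normD. Qed.

Lemma nmN x : nm (- x) = nm x.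
Proof. by apply: (@complexI R); rewrite -!nmE normrN. Qed.

Lemma nmBC x y : nm (x - y) = nm (y - x).
Proof. by rewrite -nmN opprB. Qed.

Lemma nm0 : nm 0 = 0.
Proof. by apply: (@complexI R); rewrite -!nmE normr0. Qed.

Lemma nm1 : nm 1 = 1.
Proof. by apply: (@complexI R); rewrite -!nmE normr1. Qed.

Lemma nm_eq0 x : (nm x == 0) = (x == 0).
Proof.
by rewrite -(inj_eq (@complexI R)) -nmE rmorph0 normr_eq0.
Qed.

Lemma nm_gt0 x : x != 0 -> 0 < nm x.
Proof. by rewrite lt_def nm_ge0 nm_eq0 andbT. Qed.

Lemma nmX x n : nm (x ^+ n) = nm x ^+ n.
Proof. by elim: n => [|n IH]; rewrite ?nm1 // !exprS nmM IH. Qed.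

Lemma nmV x : nm x^-1 = (nm x)^-1.
Proof. by apply: (@complexI R); rewrite fmorphV -!nmE normfV. Qed.

Lemma nm_prod I (s : seq I) (P : pred I) (F : I -> R[i]) :
  nm (\prod_(i <- s | P i) F i) = \prod_(i <- s | P i) nm (F i).
Proof. exact: (big_morph nm nmM nm1). Qed.

Lemma nm_sum I (s : seq I) (P : pred I) (F : I -> R[i]) :
  nm (\sum_(i <- s | P i) F i) <= \sum_(i <- s | P i) nm (F i).
Proof.
apply: (big_ind2 (fun a b => nm a <= b)) => [|a b c d ab cd|//]; first by rewrite nm0.
by rewrite (le_trans (nmD _ _)) // lerD.
Qed.

Lemma nm_sub_ge x y : nm x - nm y <= nm (x - y).
Proof. by rewrite lerBlDr (le_trans _ (nmD _ _)) // subrK. Qed.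

Lemma nm_Re x : `|complex.Re x| <= nm x.
Proof. by rewrite -lecR -nmE normc_ge_Re. Qed.

Lemma nm_Im x : `|complex.Im x| <= nm x.
Proof.
have -> : complex.Im x = complex.Re (- 'i * x) by case: x => a b; simpc.
rewrite (le_trans (nm_Re _)) // nmM nmN; suff -> : nm 'i = 1 by rewrite mul1r.
by rewrite /nm normc_def /= expr0n expr1n add0r sqrtr1.
Qed.

Lemma nm_le_ReIm x : nm x <= `|complex.Re x| + `|complex.Im x|.
Proof.
have nmC (a : R) : nm a%:C = `|a|.
  by rewrite /nm normc_def /= expr0n addr0 sqrtr_sqr.
rewrite {1}[x]complexE (le_trans (nmD _ _)) // nmM !nmC.
suff -> : nm 'i = 1 by rewrite mul1r.
by rewrite /nm normc_def /= expr0n expr1n add0r sqrtr1.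
Qed.

End Modulus.

Section GeometricLimits.
Variables (R : realType) (r : R).
Hypotheses (r0 : 0 < r) (r1 : r < 1).
Implicit Types (u v : nat -> R[i]) (l : R[i]).

(* Every limit below is attained at the common geometric rate [r]. *)
Definition gconv u l := exists C : R, forall n, nm (u n - l) <= C * r ^+ n.

Lemma expr_small (e : R) : 0 < e -> exists n, r ^+ n < e.
Proof.
move=> e0; have r1' : `|r| < 1 by rewrite gtr0_norm.
have /cvgrPdist_lt/(_ e e0)[N _ /(_ N)/=] := cvg_expr r1'.
rewrite leqnn => /(_ isT); rewrite sub0r normrN gtr0_norm ?exprn_gt0 // => ?.
by exists N.
Qed.

Lemma bound_small (C e : R) : 0 < e -> exists n, C * r ^+ n < e.
Proof.
move=> e0; have C1 : 0 < `|C| + 1 by rewrite ltr_wpDl.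
have [n rn] := expr_small (divr_gt0 e0 C1); exists n.
have rn0 : 0 <= r ^+ n by rewrite exprn_ge0 // ltW.
rewrite (le_lt_trans (ler_wpM2r rn0 (_ : C <= `|C| + 1))) //.
  by rewrite (le_trans (ler_norm _)) // lerDl.
by rewrite mulrC -ltr_pdivlMr.
Qed.

Lemma gconv_bound u l : gconv u l -> exists2 C, 0 <= C & forall n, nm (u n - l) <= C * r ^+ n.
Proof.
case=> C uC; exists C => //; have := uC 0%N; rewrite mulr1.
exact/le_trans/nm_ge0.
Qed.

Lemma expr_le1 n : r ^+ n <= 1.
Proof. by rewrite exprn_ile1 // ltW. Qed.

Lemma expr_gt0 n : 0 < r ^+ n.
Proof. by rewrite exprn_gt0. Qed.

Lemma gconvD u v l k : gconv u l -> gconv v k -> gconv (fun n => u n + v n) (l + k).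
Proof.
case=> C uC [D vD]; exists (C + D) => n.
by rewrite opprD addrACA (le_trans (nmD _ _)) // mulrDl lerD.
Qed.

Lemma gconvN u l : gconv u l -> gconv (fun n => - u n) (- l).
Proof. by case=> C uC; exists C => n; rewrite -opprD nmN. Qed.

Lemma gconv_cst l : gconv (fun=> l) l.
Proof. by exists 0 => n; rewrite subrr nm0 mul0r. Qed.

Lemma gconvM u v l k : gconv u l -> gconv v k -> gconv (fun n => u n * v n) (l * k).
Proof.
move=> /gconv_bound[C C0 uC] /gconv_bound[D D0 vD].
exists (C * (D + nm k) + nm l * D) => n.
have -> : u n * v n - l * k = (u n - l) * v n + l * (v n - k) by ring.
have vn : nm (v n) <= D + nm k.
  rewrite -[v n](subrK k) (le_trans (nmD _ _)) // lerD2r (le_trans (vD n)) //.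
  by rewrite ler_piMr // expr_le1.
rewrite (le_trans (nmD _ _)) // !nmM mulrDl lerD //.
  by rewrite mulrAC ler_pM ?nm_ge0 // mulr_ge0 // ltW ?expr_gt0.
by rewrite -mulrA ler_wpM2l ?nm_ge0.
Qed.

Lemma gconv_ext u v l : (forall n, u n = v n) -> gconv u l -> gconv v l.
Proof. by move=> uv [C uC]; exists C => n; rewrite -uv. Qed.

Lemma gconv_uniq u l k : gconv u l -> gconv u k -> l = k.
Proof.
case=> C uC [D uD]; apply/eqP; rewrite -subr_eq0 -nm_eq0; apply/negPn/negP => lk.
have lk0 : 0 < nm (l - k) by rewrite lt_def lk nm_ge0.
have [n] := bound_small (C + D) lk0; apply/negP; rewrite -leNgt.
have -> : l - k = (u n - k) - (u n - l) by ring.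
by rewrite (le_trans (nmD _ _)) // nmN addrC mulrDl lerD.
Qed.

Lemma gconv_eps u l : gconv u l ->
  forall e : R[i], 0 < e -> exists n, forall k, (n <= k)%N -> `|l - u k| < e.
Proof.
move=> /gconv_bound[C C0 uC] e e0.
have eE : e = (complex.Re e)%:C by rewrite RRe_real // gtr0_real.
move: e0; rewrite eE -(rmorph0 (real_complex R)) ltcR => e0.
have [n rn] := bound_small C e0; exists n => // k /= nk.
rewrite nmE ltcR nmBC (le_lt_trans (uC k)) // (le_lt_trans _ rn) //.
by rewrite ler_wpM2l // ler_wiXn2l // ltW.
Qed.

(** The intervals of centre [a n] and radius [D * r ^+ n] are nested, by the choice of
    [D = C / (1 - r)]; the supremum of their left ends lies in all of them. *)
Lemma real_geometric_cauchy (a : nat -> R) (C : R) : 0 <= C ->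
  (forall n, `|a n.+1 - a n| <= C * r ^+ n) ->
  exists L : R, forall n, `|a n - L| <= C / (1 - r) * r ^+ n.
Proof.
move=> C0 aC; pose D := C / (1 - r).
have r1' : 1 - r != 0 by rewrite subr_eq0 eq_sym lt_eqF.
have D0 : 0 <= D by rewrite divr_ge0 // subr_ge0 ltW.
have DE n : D * r ^+ n - D * r ^+ n.+1 = C * r ^+ n.
  by rewrite exprS /D; field.
have lo n k : a n - D * r ^+ n <= a (n + k)%N - D * r ^+ (n + k).
  elim: k => [|k IH]; first by rewrite addn0.
  rewrite (le_trans IH) // addnS; have := DE (n + k)%N; have := aC (n + k)%N.
  by rewrite ler_norml => /andP[]; lra.
have hi n k : a (n + k)%N + D * r ^+ (n + k) <= a n + D * r ^+ n.
  elim: k => [|k IH]; first by rewrite addn0.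
  rewrite (le_trans _ IH) // addnS; have := DE (n + k)%N; have := aC (n + k)%N.
  by rewrite ler_norml => /andP[]; lra.
have lohi n k : a n - D * r ^+ n <= a k + D * r ^+ k.
  have := lo n k; have := hi k n; rewrite [(k + n)%N]addnC.
  have := mulr_ge0 D0 (ltW (expr_gt0 (n + k))); lra.
pose E := range (fun n => a n - D * r ^+ n).
have supE : has_sup E.
  split; first by exists (a 0%N - D * r ^+ 0), 0%N.
  by exists (a 0%N + D * r ^+ 0) => _ [n _ <-]; apply: lohi.
exists (sup E) => n; rewrite ler_distlC; apply/andP; split.
  by apply: sup_upper_bound => //; exists n.
by apply: ge_sup; [case: supE|move=> _ [k _ <-]; apply: lohi].
Qed.

Lemma gconv_cauchy u (C : R) :
  (forall n, nm (u n.+1 - u n) <= C * r ^+ n) -> exists l, gconv u l.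
Proof.
move=> uC.
have C0 : 0 <= C by have := uC 0%N; rewrite mulr1; apply/le_trans/nm_ge0.
have [n|a ua] := @real_geometric_cauchy (fun n => complex.Re (u n)) C C0.
  rewrite (le_trans _ (uC n)) //; apply: le_trans (nm_Re _).
  by rewrite raddfB.
have [n|b ub] := @real_geometric_cauchy (fun n => complex.Im (u n)) C C0.
  rewrite (le_trans _ (uC n)) //; apply: le_trans (nm_Im _).
  by rewrite raddfB.
exists (a +i* b), (C / (1 - r) + C / (1 - r)) => n.
rewrite (le_trans (nm_le_ReIm _)) // mulrDl lerD //.
  by apply: le_trans (ua n); case: (u n) => x y /=.
by apply: le_trans (ub n); case: (u n) => x y /=.
Qed.

End GeometricLimits.

Lemma lim_eps (K : numFieldType) (u : nat -> K) (l : K) :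
  (forall e : K, 0 < e -> exists n, forall k, (n <= k)%N -> `|l - u k| < e) ->
  lim (u @ \oo)%classic = l.
Proof.
move=> ul; apply: cvg_lim; first exact: norm_hausdorff.
by apply/cvgrPdist_lt => e /ul[n un]; exists n.
Qed.

(** * The Jacobi triple product *)

(* Locked because unification otherwise computes the list down to a [::]. *)
Definition box (N : nat) : seq int := locked [seq i%:Z - N%:Z | i <- iota 0 N.*2.+1].

Lemma mem_box N (k : int) : (k \in box N) = (`|k| <= N)%N.
Proof.
rewrite /box -lock; apply/mapP/idP => [[i + ->]|kN]; first by rewrite mem_iota; lia.
by exists (absz (k + N%:Z)); [rewrite mem_iota; lia|lia].
Qed.

Lemma box_uniq N : uniq (box N).
Proof. by rewrite /box -lock map_inj_uniq ?iota_uniq // => i j; lia. Qed.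

Lemma sum_box_recr (V : nmodType) N (F : int -> V) :
  \sum_(k <- box N.+1) F k = \sum_(k <- box N) F k + F N.+1%:Z + F (- N.+1%:Z).
Proof.
have P : perm_eq (box N.+1) (N.+1%:Z :: - N.+1%:Z :: box N).
  apply: uniq_perm; rewrite ?box_uniq //.
    rewrite 2!cons_uniq box_uniq in_cons !mem_box andbT; apply/andP; split; [|lia].
    by rewrite negb_or; apply/andP; split; [apply/eqP|]; lia.
  move=> k; rewrite mem_box; have := mem_box N k; move: (box N) => b bE.
  by rewrite !in_cons bE; apply/idP/idP; lia.
have -> : \sum_(k <- box N.+1) F k = \sum_(k <- N.+1%:Z :: - N.+1%:Z :: box N) F k.
  exact: perm_big.
by rewrite 2!big_cons addrA addrC addrA.
Qed.

Lemma sum_box0 (V : nmodType) (F : int -> V) : \sum_(k <- box 0) F k = F 0.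
Proof. by rewrite /box -lock big_seq1. Qed.

Lemma sum_half_box (R : realFieldType) N : \sum_(k <- box N) (1 / 2 : R) ^+ `|k|%N <= 3.
Proof.
suff : \sum_(k <- box N) (1 / 2 : R) ^+ `|k|%N = 3 - 2 * (1 / 2) ^+ N.
  by move=> ->; have := exprn_ge0 N (_ : 0 <= 1 / 2 :> R) => /(_ ltac:(lra)); lra.
elim: N => [|N IH]; first by rewrite sum_box0 /= !expr0; ring.
by rewrite sum_box_recr IH abszN absz_nat exprS; field.
Qed.

Section FiniteSumComparison.
Variable (R : realFieldType).

Lemma sum_sub_le (I : eqType) (X Z : seq I) (f : I -> R) :
  uniq X -> uniq Z -> {subset X <= Z} -> (forall i, 0 <= f i) ->
  \sum_(i <- X) f i <= \sum_(i <- Z) f i.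
Proof.
move=> uX uZ XZ f0.
have P : perm_eq X [seq i <- Z | i \in X].
  apply: uniq_perm => // [|i]; first by rewrite filter_uniq.
  by rewrite mem_filter; case iX: (i \in X); rewrite //= XZ.
rewrite (perm_big _ P) big_filter big_mkcond; apply: ler_sum => i _.
by case: ifP.
Qed.

Definition size2 (k : int * int) := (`|k.1| + `|k.2|)%N.

Lemma sum_half_size2 (X : seq (int * int)) : uniq X ->
  \sum_(k <- X) (1 / 2 : R) ^+ size2 k <= 9.
Proof.
move=> uX; pose M := (\max_(k <- X) size2 k)%N.
have h0 n : 0 <= (1 / 2 : R) ^+ n by rewrite exprn_ge0 // divr_ge0.
apply: (@le_trans _ _ (\sum_(k <- [seq (i, j) | i <- box M, j <- box M]) (1 / 2 : R) ^+ size2 k)).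
  apply: sum_sub_le => //; first by apply: allpairs_uniq; rewrite ?box_uniq // => -[? ?] [? ?].
  move=> [i j] ijX; have : (size2 (i, j) <= M)%N by apply: leq_bigmax_seq.
  rewrite /size2 /= => H.
  by apply/allpairsPdep; exists i, j; rewrite !mem_box; split => //; lia.
rewrite big_allpairs /=.
rewrite (eq_bigr (fun i : int => (1 / 2) ^+ `|i|%N * \sum_(j <- box M) (1 / 2 : R) ^+ `|j|%N)).
  rewrite -mulr_suml (_ : 9 = 3 * 3); last by ring.
  by apply: ler_pM; rewrite ?sum_half_box // sumr_ge0.
by move=> i _; rewrite mulr_sumr; apply: eq_bigr => j _; rewrite exprD.
Qed.

End FiniteSumComparison.

(* [k * (k - 1) / 2] for every integer [k]. *)
Definition t2 (k : int) : nat := match k with Posz n => 'C(n, 2) | Negz n => 'C(n.+2, 2) end.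

Lemma bin2_double n : ('C(n, 2) * 2 = n * n.-1)%N.
Proof.
elim: n => // n IH; rewrite binS bin1 mulnDl IH.
by case: n {IH} => //= n; lia.
Qed.

Lemma t2_double k : (t2 k)%:Z * 2 = k * (k - 1).
Proof.
case: k => [[|n]|n] //; rewrite /t2.
  by have := bin2_double n.+1; rewrite /=; lia.
by have := bin2_double n.+2; rewrite /= NegzE; lia.
Qed.

Lemma bin2_le_t2 k : ('C(`|k|, 2) <= t2 k)%N.
Proof.
by case: k => [n|n]; rewrite /t2 ?absz_nat // NegzE abszN absz_nat binS leq_addr.
Qed.

(** * Gaussian binomials and the finite triple product *)

Section FiniteJacobi.
Variables (K : fieldType) (p : K).
Hypothesis p1 : forall n, p ^+ n.+1 != 1.

(** [qfac n] is [(p; p)_n], [qbin] the Gaussian binomial coefficient and [sterm x] the general term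
    of the Jacobi series. *)
Definition qfac n := \prod_(0 <= j < n) (1 - p ^+ j.+1).
Definition qbin M i := if (i <= M)%N then qfac M / (qfac i * qfac (M - i)) else 0.
Definition sterm (x : K) (k : int) := (-1) ^+ `|k|%N * p ^+ t2 k * x ^ k.

Lemma qfac_neq0 n : qfac n != 0.
Proof.
rewrite /qfac big_mkord; apply/prodf_neq0 => j _.
by rewrite subr_eq0 eq_sym p1.
Qed.

Lemma qfacS n : qfac n.+1 = qfac n * (1 - p ^+ n.+1).
Proof. by rewrite /qfac big_nat_recr. Qed.

Lemma qfac0 : qfac 0 = 1.
Proof. by rewrite /qfac big_nil. Qed.

Lemma qbin_pascal M i : (i <= M)%N ->
  qbin M.+1 i.+1 = qbin M i.+1 + p ^+ (M - i) * qbin M i.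
Proof.
move=> iM; have q0 := qfac_neq0; rewrite /qbin ltnS iM subSS.
have [->|iM'] := eqVneq i M.
  by rewrite ltnn subnn qfac0 expr0 add0r mul1r !mulr1 !divff.
have {}iM : (i < M)%N by rewrite ltn_neqAle iM' iM.
rewrite iM.
rewrite -(subnSK iM) !qfacS.
set d := (M - i.+1)%N.
have -> : M.+1 = (i.+1 + d.+1)%N by rewrite /d; lia.
have n1 := p1 i; have n2 := p1 d.
rewrite exprD; field.
by rewrite !q0 !subr_eq0 ![1 == _]eq_sym p1 p1.
Qed.

Lemma gauss_binomial M y :
  \prod_(0 <= j < M) (1 - y * p ^+ j) =
  \sum_(0 <= i < M.+1) (-1) ^+ i * p ^+ 'C(i, 2) * qbin M i * y ^+ i.
Proof.
elim: M => [|M IH].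
  have q00 : qbin 0 0 = 1 by rewrite /qbin subnn qfac0 mulr1 divr1.
  by rewrite big_nil big_nat1 q00 !mulr1.
pose A M i := (-1) ^+ i * p ^+ 'C(i, 2) * qbin M i * y ^+ i.
have A0 m : A m 0%N = 1.
  by rewrite /A /qbin subn0 qfac0 [1 * qfac m]mul1r divff ?qfac_neq0 // !mulr1.
have AS i : (i <= M)%N -> A M.+1 i.+1 = A M i.+1 - y * p ^+ M * A M i.
  move=> iM; rewrite /A qbin_pascal // binS bin1 !exprD.
  by rewrite -[in p ^+ M](subnK iM) exprD !exprS; ring.
rewrite big_nat_recr //= IH -[RHS]/(\sum_(0 <= i < M.+2) A M.+1 i) [RHS]big_nat_recl // A0.
rewrite [X in _ = _ + X](eq_big_nat _ _ (F2 := fun i => A M i.+1 - y * p ^+ M * A M i)); last first.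
  by move=> i /andP[_ iM]; rewrite AS.
rewrite sumrB -mulr_sumr.
pose S := \sum_(0 <= i < M.+1) A M i; rewrite -!/S.
suff -> : \sum_(0 <= i < M.+1) A M i.+1 = S - 1 by ring.
have : \sum_(0 <= i < M.+2) A M i = S.
  by rewrite big_nat_recr //= {2}/A /qbin ltnn mulr0 mul0r addr0.
by rewrite big_nat_recl // A0 => <-; ring.
Qed.

Definition tprod x N := \prod_(0 <= j < N) ((1 - p ^+ j * x) * (1 - p ^+ j.+1 / x)).

(** The case [M = 2 N], [y = x / p ^+ N] of [gauss_binomial]: inverting the first [N] factors gives
    the half in [1 / x] up to a monomial, and the summation index is recentred at [N]. *)
Lemma finite_jacobi x N : p != 0 -> x != 0 ->
  tprod x N = \sum_(k <- box N) qbin N.*2 (absz (k + N%:Z)) * sterm x k.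
Proof.
move=> p0 x0.
have pn0 n : p ^+ n != 0 by rewrite expf_neq0.
have xn0 n : x ^+ n != 0 by rewrite expf_neq0.
have E : tprod x N * ((-1) ^+ N * x ^+ N / p ^+ 'C(N.+1, 2)) =
         \prod_(0 <= j < N.*2) (1 - x / p ^+ N * p ^+ j).
  have H1 : \prod_(0 <= j < N) (- x / p ^+ j.+1) = (-1) ^+ N * x ^+ N / p ^+ 'C(N.+1, 2).
    elim: N => [|N IH]; first by rewrite big_nil bin_small // !mulr1 divr1.
    by rewrite big_nat_recr //= IH ['C(N.+2, 2)]binS bin1 exprD !exprS; field; rewrite !pn0 p0.
  have H2 : \prod_(0 <= j < N) (1 - x / p ^+ N * p ^+ j) =
            \prod_(0 <= j < N) (- x / p ^+ j.+1) * \prod_(0 <= j < N) (1 - p ^+ j.+1 / x).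
    rewrite big_nat_rev -big_split /= add0n; apply: eq_big_nat => j /andP[_ jN].
    rewrite -{1}(subnK jN) exprD; field.
    by rewrite x0 !pn0.
  have H3 : \prod_(N <= j < N.*2) (1 - x / p ^+ N * p ^+ j) =
            \prod_(0 <= j < N) (1 - p ^+ j * x).
    rewrite -{1}[N]add0n big_addn -addnn addnK; apply: eq_bigr => j _.
    by rewrite exprD; field.
  rewrite [RHS](big_cat_nat _ (n := N)) //=; last by rewrite -addnn leq_addr.
  by rewrite H2 H3 H1 /tprod big_split /=; ring.
have c0 : (-1) ^+ N * x ^+ N / p ^+ 'C(N.+1, 2) != 0.
  by rewrite !mulf_neq0 ?invr_eq0 ?expf_neq0 // oppr_eq0 oner_eq0.
apply: (mulIf c0); rewrite E gauss_binomial /box -lock big_map mulr_suml.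
rewrite /index_iota subn0; apply: eq_bigr => i _; rewrite subrK absz_nat /sterm.
have -> : x ^ (i%:Z - N%:Z) = x ^+ i / x ^+ N.
  by rewrite expfzDr // -exprnN.
have sE : (-1) ^+ `|i%:Z - N%:Z|%N * (-1) ^+ N = (-1) ^+ i :> K.
  have [NI|/ltnW iN] := leqP N i.
    by rewrite -{2}(subnK NI) exprD subzn.
  rewrite -{2}(subnK iN) exprD mulrA distnC subzn // absz_nat -exprD addnn.
  by rewrite -signr_odd odd_double mul1r.
have tE : p ^+ 'C(i, 2) * p ^+ 'C(N.+1, 2) = p ^+ t2 (i%:Z - N%:Z) * p ^+ (N * i).
  rewrite -!exprD; congr (_ ^+ _).
  have := t2_double (i%:Z - N%:Z); have := bin2_double i; have := bin2_double N.+1.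
  by case: (i) => [|i'] /=; nia.
rewrite expr_div_n -exprM -sE.
have -> : p ^+ 'C(i, 2) = p ^+ t2 (i%:Z - N%:Z) * p ^+ (N * i) / p ^+ 'C(N.+1, 2).
  by rewrite -tE mulfK.
by field; rewrite !pn0 xn0.
Qed.

End FiniteJacobi.

(** * Uniform bounds for infinite products *)

Section InfiniteProducts.
Variables (R : realType) (r : R).
Hypotheses (r0 : 0 < r) (r1 : r < 1).

Lemma expr_le_add m n : r ^+ (m + n) <= r ^+ m.
Proof. by rewrite ler_wiXn2l ?leq_addr // ltW. Qed.

Lemma geometric_sum_le n : \sum_(0 <= j < n) r ^+ j <= (1 - r)^-1.
Proof.
have r1' : 0 < 1 - r by rewrite subr_gt0.
rewrite -[leRHS]mul1r ler_pdivlMr //.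
have -> : (\sum_(0 <= j < n) r ^+ j) * (1 - r) = 1 - r ^+ n.
  elim: n => [|n IH]; first by rewrite big_nil mul0r subrr.
  by rewrite big_nat_recr //= mulrDl IH exprS; ring.
by rewrite lerBlDr lerDl exprn_ge0 // ltW.
Qed.

(** The Weierstrass product inequality; the hypotheses put every factor in [[0, 1]]. *)
Lemma prod_1B_ge (C : R) m n : 0 <= C -> C * r ^+ m <= 1 ->
  1 - C * \sum_(0 <= j < n) r ^+ (m + j) <= \prod_(0 <= j < n) (1 - C * r ^+ (m + j)).
Proof.
move=> C0 Cm; elim: n => [|n IH]; first by rewrite !big_nil mulr0 subr0.
rewrite !big_nat_recr //=.
have e0 : 0 <= C * r ^+ (m + n) by rewrite mulr_ge0 // exprn_ge0 // ltW.
have e1 : C * r ^+ (m + n) <= 1.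
  apply: le_trans Cm; rewrite ler_wpM2l //.
  exact: expr_le_add.
have s0 : 0 <= C * \sum_(0 <= j < n) r ^+ (m + j).
  by rewrite mulr_ge0 // sumr_ge0 // => j _; rewrite exprn_ge0 // ltW.
apply: le_trans (ler_wpM2r _ IH); last by rewrite subr_ge0.
move: e0 e1 s0; rewrite mulrDr; set e := C * r ^+ _; set s := C * \sum_(_ <= _ < _) _.
by move=> e0 e1 s0; have := mulr_ge0 s0 e0; nra.
Qed.

(** From some [J] on the bounds [C * r ^+ j] sum to at most [1 / 2], so that tail products are at
    least [1 / 2]; the earlier factors, finitely many and nonzero, are put back one at a time. *)
Lemma prod_lower_bound (e : nat -> R[i]) (C : R) :
  (forall j, nm (e j) <= C * r ^+ j) -> (forall j, e j != 1) ->
  exists2 d, 0 < d & forall n, d <= nm (\prod_(0 <= j < n) (1 - e j)).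
Proof.
move=> eC e1.
have C0 : 0 <= C by have := eC 0%N; rewrite mulr1; apply/le_trans/nm_ge0.
have r1' : 0 < 1 - r by rewrite subr_gt0.
have [J CJ] : exists J, C * r ^+ J < (1 - r) / 2 by apply: bound_small; rewrite ?divr_gt0.
suff H m : (m <= J)%N ->
    exists2 d, 0 < d & forall n, d <= nm (\prod_(0 <= j < n) (1 - e (J - m + j)%N)).
  have [d d0 dn] := H J (leqnn J); exists d => // n.
  by apply: le_trans (dn n) _; rewrite subnn.
elim: m => [_|m IH mJ].
  exists (1 / 2) => [|n]; first by rewrite divr_gt0.
  rewrite subn0 nm_prod.
  apply: (@le_trans _ _ (\prod_(0 <= j < n) (1 - C * r ^+ (J + j)))).
    have CJ1 : C * r ^+ J <= 1 by move: CJ r0; lra.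
    apply: le_trans (prod_1B_ge n C0 CJ1).
    have -> : \sum_(0 <= j < n) r ^+ (J + j) = r ^+ J * \sum_(0 <= j < n) r ^+ j.
      by rewrite mulr_sumr; apply: eq_bigr => j _; rewrite exprD.
    rewrite mulrA.
    have := ler_wpM2l (mulr_ge0 C0 (ltW (expr_gt0 r0 J))) (geometric_sum_le n).
    have : C * r ^+ J * (1 - r)^-1 <= 1 / 2.
      by rewrite ler_pdivrMr //; lra.
    by lra.
  rewrite !big_mkord; apply: ler_prod => j _; apply/andP; split.
    rewrite subr_ge0; have : C * r ^+ J <= 1 by move: CJ r0; lra.
    apply: le_trans; rewrite ler_wpM2l //.
    exact: expr_le_add.
  by rewrite (le_trans _ (nm_sub_ge _ _)) // nm1 lerD2l lerN2.
have [d d0 dn] := IH (ltnW mJ).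
have n0 : 0 < nm (1 - e (J - m.+1)%N) by rewrite nm_gt0 // subr_eq0 eq_sym.
(* The [1] covers the empty product. *)
exists (Num.min 1 (nm (1 - e (J - m.+1)%N) * d)) => [|[|n]].
- by rewrite lt_min ltr01 mulr_gt0.
- by rewrite big_nil nm1 ge_min lexx.
rewrite big_nat_recl // nmM addn0 ge_min; apply/orP; right.
rewrite ler_wpM2l ?nm_ge0 // (le_trans (dn n)) //.
by rewrite le_eqVlt; apply/orP; left; apply/eqP; congr nm; apply: eq_bigr => j _;
  congr (1 - e _); lia.
Qed.

Lemma prod_upper_bound (e : nat -> R[i]) (C : R) :
  (forall j, nm (e j) <= C * r ^+ j) ->
  exists2 D, 0 < D & forall n, nm (\prod_(0 <= j < n) (1 - e j)) <= D.
Proof.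
move=> eC.
have C0 : 0 <= C by have := eC 0%N; rewrite mulr1; apply/le_trans/nm_ge0.
exists (expR (C / (1 - r))) => [|n]; first exact: expR_gt0.
rewrite nm_prod (@le_trans _ _ (\prod_(0 <= j < n) expR (C * r ^+ j))) //.
  rewrite !big_mkord; apply: ler_prod => j _; rewrite nm_ge0 /=.
  rewrite (le_trans (nmD _ _)) // nm1 nmN (le_trans _ (expR_ge1Dx _)) //.
  by rewrite lerD2l.
by rewrite -expR_sum ler_expR -mulr_sumr ler_wpM2l // geometric_sum_le.
Qed.

End InfiniteProducts.

Section QFactorial.
Variables (R : realType) (r : R) (p : R[i]).
Hypotheses (r0 : 0 < r) (r1 : r < 1) (pr : nm p <= r).

Lemma nm_exp_le n : nm (p ^+ n) <= r ^+ n.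
Proof. rewrite nmX; apply: lerXn2r => //; rewrite nnegrE ?nm_ge0 //; exact: ltW. Qed.

Lemma exp_neq1 n : p ^+ n.+1 != 1.
Proof.
apply/negP => /eqP e; have := nm_exp_le n.+1; rewrite e nm1 leNgt => /negP; apply.
by rewrite exprn_ilt1 // ltW.
Qed.

Lemma qfac_term n : nm (p ^+ n.+1) <= 1 * r ^+ n.
Proof.
rewrite mul1r (le_trans (nm_exp_le _)) // exprS ler_piMl ?exprn_ge0 // ltW //.
Qed.

Lemma qfac_bounds : exists d D, [/\ 0 < d, 0 < D,
  forall n, d <= nm (qfac p n) & forall n, nm (qfac p n) <= D].
Proof.
have [d d0 dn] := prod_lower_bound r0 r1 qfac_term exp_neq1.
have [D D0 Dn] := prod_upper_bound r0 r1 qfac_term.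
by exists d, D.
Qed.

Lemma qfac_gconv : exists2 L, L != 0 & gconv r (qfac p) L.
Proof.
have [d [D [d0 D0 dn Dn]]] := qfac_bounds.
have [|L qL] := @gconv_cauchy _ _ r0 r1 (qfac p) D.
  move=> n; rewrite qfacS mulrBr mulr1 addrAC subrr sub0r nmN nmM.
  by rewrite ler_pM ?nm_ge0 //; have := qfac_term n; rewrite mul1r.
exists L => //; apply/eqP => L0; have [C qC] := qL.
have [n] := bound_small r0 r1 C d0; apply/negP; rewrite -leNgt.
by rewrite (le_trans (dn n)) // (le_trans _ (qC n)) // L0 subr0.
Qed.

End QFactorial.

(** * The triple product in the limit *)

Section JacobiTripleProduct.
Variables (R : realType) (r : R) (p : R[i]).
Hypotheses (r0 : 0 < r) (r1 : r < 1) (pr : nm p <= r).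

(** Successive quotients [t * r ^+ n] are below [1] from [n0] on; the sum of the terms up to [n0]
    stands in for their maximum. *)
Lemma super_exponential_bound (t : R) : 0 <= t ->
  exists2 C, 0 <= C & forall n, r ^+ 'C(n, 2) * t ^+ n <= C.
Proof.
move=> t0; have [n0 tn] := bound_small r0 r1 t ltr01.
pose b n := r ^+ 'C(n, 2) * t ^+ n.
have b0 n : 0 <= b n by rewrite mulr_ge0 ?exprn_ge0 // ltW.
have bS n : b n.+1 = b n * (t * r ^+ n).
  by rewrite /b binS bin1 exprD exprS; ring.
exists (\sum_(0 <= j < n0.+1) b j) => [|n]; first by rewrite sumr_ge0.
have H n' : (n' <= n0)%N -> b n' <= \sum_(0 <= j < n0.+1) b j.
  move=> nn; rewrite big_mkord (bigD1 (Ordinal (nn : (n' < n0.+1)%N))) //= lerDl.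
  by rewrite sumr_ge0.
rewrite -/(b n); have [nn|nn] := leqP n n0; first exact: H.
rewrite -(subnK (ltnW nn)); elim: (n - n0)%N => [|k IH]; first exact: H.
apply: le_trans IH; rewrite addSn bS ler_piMr //.
apply: le_trans (ltW tn); rewrite ler_wpM2l // addnC; exact: expr_le_add.
Qed.

(** The rate is [r / 2] rather than [r] so that, once a power of [r] is extracted, a summable weight
    [(1 / 2) ^+ |k|] remains. *)
Lemma sterm_bound x : x != 0 -> exists2 C, 0 <= C &
  forall k, nm (sterm p x k) <= C * (r / 2) ^+ `|k|%N.
Proof.
(* This [t] dominates both [nm x] and its inverse, hence serves both signs of [k]. *)
move=> x0; pose t := nm x + (nm x)^-1.
have nx0 : 0 < nm x by apply: nm_gt0.
have t0 : 0 < t by rewrite addr_gt0 ?invr_gt0.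
have [|C C0 HC] := @super_exponential_bound (t / (r / 2)).
  by rewrite ltW // !divr_gt0.
exists C => // k; rewrite /sterm !nmM nmX nmN nm1 expr1n mul1r.
have xk : nm (x ^ k) <= t ^+ `|k|%N.
  case: k => n; rewrite ?absz_nat.
    by rewrite -exprnP nmX lerXn2r ?nnegrE ?ltW // /t ltrDl invr_gt0.
  rewrite NegzE abszN absz_nat -exprnN nmV nmX -exprVn lerXn2r ?nnegrE ?invr_ge0 ?ltW //.
  by rewrite /t ltrDr.
have pk : nm (p ^+ t2 k) <= r ^+ 'C(`|k|, 2).
  rewrite (le_trans (nm_exp_le r0 pr _)) //.
  by rewrite ler_wiXn2l ?bin2_le_t2 // ltW.
have r20 : 0 < (r / 2) ^+ `|k|%N by rewrite exprn_gt0 // divr_gt0.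
rewrite (le_trans (ler_pM (nm_ge0 _) (nm_ge0 _) pk xk)) //.
have := HC `|k|%N; rewrite expr_div_n mulrA ler_pdivrMr //.
Qed.

Definition ssum x N := \sum_(k <- box N) sterm p x k.

Lemma ssum_gconv x : x != 0 -> exists S, gconv r (ssum x) S.
Proof.
move=> x0; have [C C0 HC] := sterm_bound x0.
apply: (@gconv_cauchy _ _ r0 r1 (ssum x) (C + C)) => N.
have HN k : `|k|%N = N.+1 -> nm (sterm p x k) <= C * r ^+ N.
  move=> kN; rewrite (le_trans (HC k)) // ler_wpM2l // kN.
  apply: (@le_trans _ _ (r ^+ N.+1)).
    by apply: lerXn2r; rewrite ?nnegrE; move: r0; lra.
  by rewrite ler_wiXn2l // ltW.
rewrite /ssum sum_box_recr; set s := \sum_(k <- _) _.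
have -> : s + sterm p x N.+1%:Z + sterm p x (- N.+1%:Z) - s =
  sterm p x N.+1%:Z + sterm p x (- N.+1%:Z) by ring.
by rewrite (le_trans (nmD _ _)) // mulrDl lerD // HN // ?abszN absz_nat.
Qed.

(** The coefficient [(p; p)_(2N) / ((p; p)_(N+k) (p; p)_(N-k))] tends to [L / L ^+ 2], at the rate
    given by the smallest of the three indices, [N - |k|]. *)
Lemma qbin_bound L : L != 0 -> gconv r (qfac p) L -> exists2 C, 0 <= C &
  forall N k, (`|k| <= N)%N ->
    nm (qbin p N.*2 (absz (k + N%:Z)) - L^-1) <= C * r ^+ (N - absz k).
Proof.
move=> L0 /(gconv_bound)[C C0 qC].
have [d [D [d0 D0 dn Dn]]] := qfac_bounds r0 r1 pr.
have q0 := qfac_neq0 (exp_neq1 r0 r1 pr).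
have nL0 : 0 < nm L by apply: nm_gt0.
exists (C * (nm L + nm L + D) / (d * d * nm L)).
  apply: divr_ge0; last by rewrite ltW // !mulr_gt0.
  by apply: mulr_ge0 => //; apply: addr_ge0; [apply: addr_ge0|]; rewrite ltW.
move=> N k kN; rewrite /qbin; have -> : (absz (k + N%:Z)%R <= N.*2)%N = true by lia.
set i := absz _; set j := (N.*2 - i)%N; set e := (N - absz k)%N.
have [eN ei ej] : [/\ e <= N.*2, e <= i & e <= j]%N.
  by rewrite /e /j /i; move: kN; clear; split; lia.
have qe m : (e <= m)%N -> nm (qfac p m - L) <= C * r ^+ e.
  move=> em; rewrite (le_trans (qC m)) // ler_wpM2l //.
  by rewrite -(subnKC em) expr_le_add.
have -> : qfac p N.*2 / (qfac p i * qfac p j) - L^-1 =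
   ((qfac p N.*2 - L) * L - (qfac p i - L) * qfac p j - L * (qfac p j - L)) /
     (qfac p i * qfac p j * L) by field; rewrite !q0 L0.
have re0 : 0 <= r ^+ e by rewrite ltW // expr_gt0.
have num : nm ((qfac p N.*2 - L) * L - (qfac p i - L) * qfac p j - L * (qfac p j - L))
    <= C * (nm L + nm L + D) * r ^+ e.
  have qN := qe _ eN; have qi := qe _ ei; have qj := qe _ ej.
  rewrite (le_trans (nmD _ _)) // nmN (le_trans (lerD (nmD _ _) (lexx _))) // nmN !nmM.
  have := ler_wpM2r (nm_ge0 L) qN; have := ler_wpM2l (nm_ge0 L) qj.
  have := ler_pM (nm_ge0 _) (nm_ge0 _) qi (Dn j); lra.
have den : (nm (qfac p i * qfac p j * L))^-1 <= (d * d * nm L)^-1.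
  rewrite lef_pV2 ?posrE ?mulr_gt0 ?nm_gt0 ?mulf_neq0 // !nmM.
  by rewrite ler_pM2r // ler_pM // ltW.
rewrite nmM nmV (le_trans (ler_pM (nm_ge0 _) _ num den)) ?invr_ge0 ?nm_ge0 //.
by rewrite mulrAC.
Qed.

Lemma tprod_gconv x L S : p != 0 -> x != 0 -> L != 0 ->
  gconv r (qfac p) L -> gconv r (ssum x) S -> gconv r (tprod p x) (L^-1 * S).
Proof.
move=> p0 x0 L0 qL xS; have [C C0 HC] := qbin_bound L0 qL.
have [D D0 HD] := sterm_bound x0.
have [E HE] : gconv r (fun N => tprod p x N - L^-1 * ssum x N) 0; last first.
  have := gconvD (ex_intro _ E HE : gconv r _ 0) (gconvM r0 r1 (gconv_cst r L^-1) xS).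
  by rewrite add0r; apply: gconv_ext => N; rewrite subrK.
(* The coefficient error [r ^+ (N - |k|)] times the term bound [(r / 2) ^+ |k|] is
   [r ^+ N * (1 / 2) ^+ |k|], and these weights sum to at most [3]. *)
exists (C * D * 3) => N; rewrite subr0 (finite_jacobi (exp_neq1 r0 r1 pr)) //.
rewrite mulr_sumr -sumrB (le_trans (nm_sum _ _ _)) //.
apply: (@le_trans _ _ (\sum_(k <- box N) C * D * r ^+ N * (1 / 2) ^+ `|k|%N)).
  rewrite big_seq [leRHS]big_seq; apply: ler_sum => k; rewrite mem_box => kN.
  rewrite -mulrBl nmM (le_trans (ler_pM (nm_ge0 _) (nm_ge0 _) (HC N k kN) (HD k))) //.
  rewrite -{2}(subnK kN) [r ^+ (_ + _)]exprD exprMn div1r.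
  by rewrite le_eqVlt; apply/orP; left; apply/eqP; ring.
rewrite -mulr_sumr -mulrA [_ ^+ N * _]mulrC mulrA ler_wpM2r ?(ltW (expr_gt0 r0 _)) //.
by rewrite ler_wpM2l ?mulr_ge0 // sum_half_box.
Qed.

Lemma theta_limit x l : gconv r (tprod p x) l -> theta p x = l.
Proof. by move=> /(gconv_eps r0 r1) xl; apply: lim_eps. Qed.

Lemma tprod_p0 x : p = 0 -> gconv r (tprod p x) (1 - x).
Proof.
move=> p0; exists (nm x) => -[|N]; rewrite /tprod.
  by rewrite big_nil subKr mulr1.
rewrite big_nat_recl // big1 => [|j _]; last by rewrite p0 !expr0n /= mul0r mul0r !subr0 mulr1.
rewrite p0 expr0 expr1 mul1r mul0r subr0 !mulr1 subrr nm0.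
by rewrite mulr_ge0 ?nm_ge0 // ltW // expr_gt0.
Qed.

Lemma theta_gconv x : x != 0 -> gconv r (tprod p x) (theta p x).
Proof.
move=> x0; have [p0|p0] := eqVneq p 0.
  by rewrite (theta_limit (tprod_p0 x p0)); apply: tprod_p0.
have [L L0 qL] := qfac_gconv r0 r1 pr; have [S xS] := ssum_gconv x0.
have xT := tprod_gconv p0 x0 L0 qL xS.
by rewrite (theta_limit xT).
Qed.

Lemma theta_jacobi : p != 0 -> exists2 L, L != 0 &
  forall x, x != 0 -> gconv r (ssum x) (L * theta p x).
Proof.
move=> p0; have [L L0 qL] := qfac_gconv r0 r1 pr; exists L => // x x0.
have [S xS] := ssum_gconv x0.
by rewrite (theta_limit (tprod_gconv p0 x0 L0 qL xS)) mulVKf.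
Qed.

(** * Parity splitting of the double series, with truncations [asum] and [bsum] of [A] and [B] *)

Definition asum y N := \sum_(s <- box N) p ^+ absz (s * s) * y ^ (2 * s).
Definition bsum y N := \sum_(s <- box N) p ^+ absz (s * (s + 1)) * y ^ (2 * s + 1).

(** The two sums agree on the ball [size2 k < N]. Outside it [r ^+ size2 k] is at most [r ^+ N], and
    the remaining weights sum to at most [9] for each index set. *)
Lemma sum_compare (v : int * int -> R[i]) C N (X Y : seq (int * int)) : 0 <= C ->
  (forall k, nm (v k) <= C * (r ^+ size2 k * (1 / 2) ^+ size2 k)) ->
  uniq X -> uniq Y ->
  (forall k, (size2 k < N)%N -> k \in X) -> (forall k, (size2 k < N)%N -> k \in Y) ->
  nm (\sum_(k <- X) v k - \sum_(k <- Y) v k) <= C * 18 * r ^+ N.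
Proof.
move=> C0 vC uX uY NX NY; pose P k := (size2 k < N)%N.
have h0 n : 0 <= (1 / 2 : R) ^+ n by rewrite exprn_ge0 // divr_ge0.
have rn0 n : 0 <= r ^+ n by rewrite ltW // expr_gt0.
have tail Z : uniq Z -> nm (\sum_(k <- Z | ~~ P k) v k) <= C * 9 * r ^+ N.
  move=> uZ; rewrite (le_trans (nm_sum _ _ _)) //.
  apply: (@le_trans _ _ (\sum_(k <- Z) C * r ^+ N * (1 / 2) ^+ size2 k)).
    rewrite [leRHS](bigID P) /= -[leLHS]add0r lerD //.
      by rewrite sumr_ge0 // => k _; rewrite !mulr_ge0.
    apply: ler_sum => k; rewrite /P -leqNgt => Nk; rewrite (le_trans (vC k)) // mulrA.
    by rewrite ler_wpM2r // ler_wpM2l // ler_wiXn2l // ltW.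
  rewrite -mulr_sumr -mulrA [_ ^+ N * _]mulrC mulrA ler_wpM2r ?(ltW (expr_gt0 r0 _)) //.
  by rewrite ler_wpM2l // sum_half_size2.
have core : \sum_(k <- X | P k) v k = \sum_(k <- Y | P k) v k.
  rewrite -[LHS]big_filter -[RHS]big_filter; apply: perm_big.
  apply: uniq_perm; rewrite ?filter_uniq // => k; rewrite !mem_filter.
  by case Pk: (P k); rewrite //= NX // NY.
rewrite (bigID P) /= core [X in _ - X](bigID P) /= opprD addrACA subrr add0r.
rewrite (le_trans (nmD _ _)) // nmN; have := tail X uX; have := tail Y uY; lra.
Qed.

Lemma sterm_mul x y m n : x != 0 -> y != 0 ->
  sterm p (x * y) m * sterm p (x / y) n =
  (-1) ^+ (absz m + absz n) * p ^+ (t2 m + t2 n) * (x ^ (m + n) * y ^ (m - n)).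
Proof.
move=> x0 y0; rewrite /sterm !expfzMl !expfzDr // exprz_inv !exprD.
by ring.
Qed.

Lemma product_gconv x y : x != 0 -> y != 0 ->
  gconv r (fun N => ssum (x * y) N * ssum (x / y) N
     - x * (bsum x N * asum y N - asum x N * bsum y N)) 0.
Proof.
move=> x0 y0.
have [C C0 HC] := sterm_bound (mulf_neq0 x0 y0).
have [|D D0 HD] := @sterm_bound (x / y); first by rewrite mulf_neq0 ?invr_eq0.
pose v (k : int * int) := sterm p (x * y) k.1 * sterm p (x / y) k.2.
have vCD k : nm (v k) <= C * D * (r ^+ size2 k * (1 / 2) ^+ size2 k).
  rewrite nmM (le_trans (ler_pM (nm_ge0 _) (nm_ge0 _) (HC _) (HD _))) //.
  rewrite /size2 !exprD !exprMn !expr1n.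
  by rewrite le_eqVlt; apply/orP; left; apply/eqP; ring.
pose B N := [seq (i, j) | i <- box N, j <- box N].
have uB N : uniq (B N).
  by apply: allpairs_uniq; rewrite ?box_uniq // => -[? ?] [? ?].
have mB N i j : ((i, j) \in B N) = (absz i <= N)%N && (absz j <= N)%N.
  apply/allpairsPdep/andP => [[i' [j' [+ + [-> ->]]]]|[iN jN]].
    by rewrite !mem_box.
  by exists i, j; rewrite !mem_box.
(* These parametrise the pairs [(m, n)] with [m + n] even, respectively odd. The offset [1] makes
   the exponents those of [bsum] and [asum], with one spare factor [x]. *)
pose ev (k : int * int) := (k.1 + 1 + k.2, k.1 + 1 - k.2).
pose od (k : int * int) := (k.1 + 1 + k.2, k.1 - k.2).
have evi : injective ev by move=> [a b] [c d] [] /= e1 e2; congr (_, _); lia.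
have odi : injective od by move=> [a b] [c d] [] /= e1 e2; congr (_, _); lia.
(* The region covered by the products of truncated [A] and [B]; it is not the square [B N], but both
   contain the ball [size2 k < N]. *)
pose Y N := map ev (B N) ++ map od (B N).
have uY N : uniq (Y N).
  rewrite cat_uniq !map_inj_uniq // !uB andbT /=.
  apply/hasPn => _ /mapP[[a b] _ ->]; apply/mapP => -[[c d] _] [] /=; lia.
have BN N k : (size2 k < N)%N -> k \in B N.
  by case: k => i j; rewrite mB /size2 /= => ?; lia.
have YN N k : (size2 k < N)%N -> k \in Y N.
  case: k => i j; rewrite /size2 /= => ijN; rewrite mem_cat.
  have [[s e]|[s e]] : (exists s, i + j = 2 * s) \/ (exists s, i + j = 2 * s + 1).
  - have := divz_eq (i + j) 2; have := modz_ge0 (i + j) (isT : (2 : int) != 0).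
    have := ltz_pmod (i + j) (isT : 0 < (2 : int)); set d := divz _ _; set m := modz _ _.
    by move=> m2 m0 ->; case: (eqVneq m 0) => ?; [left|right]; exists d; lia.
  - apply/orP; left; apply/mapP; exists (s - 1, i - s); last by rewrite /ev /=; congr (_, _); lia.
    by rewrite mB; lia.
  - apply/orP; right; apply/mapP; exists (s, i - s - 1); last by rewrite /od /=; congr (_, _); lia.
    by rewrite mB; lia.
exists (C * D * 18) => N; rewrite subr0.
have -> : ssum (x * y) N * ssum (x / y) N = \sum_(k <- B N) v k.
  by rewrite big_allpairs /= mulr_suml; apply: eq_bigr => i _; rewrite mulr_sumr.
have -> : x * (bsum x N * asum y N - asum x N * bsum y N) = \sum_(k <- Y N) v k.
  rewrite big_cat !big_map !big_allpairs /= mulrBr; congr (_ + _).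
    rewrite /bsum mulr_suml mulr_sumr; apply: eq_bigr => i _.
    rewrite !mulr_sumr; apply: eq_bigr => j _.
    rewrite /v /ev /= sterm_mul //.
    have -> : i + 1 + j + (i + 1 - j) = 1 + (2 * i + 1) by ring.
    have -> : i + 1 + j - (i + 1 - j) = 2 * j by ring.
    have -> : (t2 (i + 1 + j) + t2 (i + 1 - j) = absz (i * (i + 1))%R + absz (j * j)%R)%N.
      by have := t2_double (i + 1 + j); have := t2_double (i + 1 - j); nia.
    have -> : (-1) ^+ (absz (i + 1 + j)%R + absz (i + 1 - j)%R) = 1 :> R[i].
      by rewrite -signr_odd (_ : odd _ = false) //; lia.
    by rewrite [x ^ (1 + _)]expfzDr // expr1z exprD; ring.
  rewrite [asum _ _ * _]mulr_suml mulr_sumr -sumrN; apply: eq_bigr => i _.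
  rewrite !mulr_sumr -sumrN; apply: eq_bigr => j _.
  rewrite /v /od /= sterm_mul //.
  have -> : i + 1 + j + (i - j) = 1 + 2 * i by ring.
  have -> : i + 1 + j - (i - j) = 2 * j + 1 by ring.
  have -> : (t2 (i + 1 + j) + t2 (i - j) = absz (i * i)%R + absz (j * (j + 1))%R)%N.
    by have := t2_double (i + 1 + j); have := t2_double (i - j); nia.
  have -> : (-1) ^+ (absz (i + 1 + j)%R + absz (i - j)%R) = -1 :> R[i].
    by rewrite -signr_odd (_ : odd _ = true) //; lia.
  by rewrite [x ^ (1 + _)]expfzDr // expr1z exprD; ring.
apply: sum_compare => //; [exact: mulr_ge0|exact: BN|exact: YN].
Qed.

End JacobiTripleProduct.

(** * The three-term relation *)

Section ThetaIdentities.
Variables (R : realType) (r : R) (p : R[i]).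
Hypotheses (r0 : 0 < r) (r1 : r < 1) (pr : nm p <= r).
Notation th := (theta p).

Lemma theta_p0 x : p = 0 -> th x = 1 - x.
Proof. by move=> p0; apply: (theta_limit r0 r1); apply: tprod_p0. Qed.

(** Some factor is zero, so all partial products from there on vanish; the order of [i] and [j]
    decides which half of the product it belongs to. *)
Lemma theta_vanish x i j : x != 0 -> p != 0 -> p ^+ i * x = p ^+ j -> th x = 0.
Proof.
move=> x0 p0 e; apply/eqP; rewrite -nm_eq0; apply/negPn/negP => tn.
have [C C0 xC] := gconv_bound (theta_gconv r0 r1 pr x0).
have t0 : 0 < nm (th x) by rewrite lt_def tn nm_ge0.
have [n] := bound_small r0 r1 C t0; apply/negP; rewrite -leNgt.
pose N := (i + j + n).+1.
have TN : tprod p x N = 0.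
  apply/eqP; rewrite /tprod big_mkord prodf_seq_eq0; apply/hasP.
  have [ij|ji] := leqP j i.
    have lt : (i - j < N)%N by rewrite /N; lia.
    exists (Ordinal lt); rewrite ?mem_index_enum //= mulf_eq0 subr_eq0; apply/orP; left.
    rewrite eq_sym; apply/eqP/(mulfI (expf_neq0 j p0)).
    by rewrite mulrA -exprD subnKC // e mulr1.
  have lt : (j - i.+1 < N)%N by rewrite /N; lia.
  exists (Ordinal lt); rewrite ?mem_index_enum //= mulf_eq0; apply/orP; right.
  rewrite subnSK // subr_eq0 eq_sym; apply/eqP/(mulfI (expf_neq0 i p0)).
  by rewrite mulrA -exprD subnKC 1?ltnW // -e mulr1 mulfK.
have := xC N; rewrite TN sub0r nmN => /le_trans; apply; rewrite ler_wpM2l //.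
by rewrite ler_wiXn2l ?(ltW r0) ?(ltW r1) // /N; lia.
Qed.

Lemma theta1 : th 1 = 0.
Proof.
have [p0|p0] := eqVneq p 0; first by rewrite theta_p0 // subrr.
by apply: (@theta_vanish 1 0 0) => //; rewrite ?oner_eq0 ?mulr1.
Qed.

(** If no factor vanishes, both halves of the partial products are bounded away from zero, hence so
    is the limit. *)
Lemma theta_eq0 x : x != 0 -> th x = 0 -> exists i j, p ^+ i * x = p ^+ j.
Proof.
move=> x0 tx; apply: contrapT => H.
have H1 j : p ^+ j * x != 1.
  by apply/negP => /eqP e; apply: H; exists j, 0%N; rewrite e.
have H2 j : p ^+ j.+1 / x != 1.
  apply/negP => /eqP e; apply: H; exists 0%N, j.+1.
  by rewrite mul1r -[x]mul1r -e divfK.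
have [|d1 d10 B1] := prod_lower_bound r0 r1 (e := fun j => p ^+ j * x) (C := nm x) _ H1.
  by move=> j; rewrite nmM mulrC ler_wpM2l ?nm_ge0 // nm_exp_le.
have [|d2 d20 B2] := prod_lower_bound r0 r1 (e := fun j => p ^+ j.+1 / x) (C := nm x^-1) _ H2.
  move=> j; rewrite nmM mulrC ler_wpM2l ?nm_ge0 //.
  by have := qfac_term r0 r1 pr j; rewrite mul1r.
have [C xC] := theta_gconv r0 r1 pr x0.
have [n] := bound_small r0 r1 C (mulr_gt0 d10 d20); apply/negP; rewrite -leNgt.
rewrite (le_trans _ (xC n)) // tx subr0 /tprod big_split nmM.
by rewrite ler_pM ?B1 ?B2 // ltW.
Qed.

Lemma theta_div_eq0 a b : a != 0 -> b != 0 -> th a = 0 -> th b = 0 -> th (a / b) = 0.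
Proof.
move=> a0 b0 ta tb; have [p0|p0] := eqVneq p 0.
  move: ta tb; rewrite !theta_p0 // => /eqP; rewrite subr_eq0 => /eqP <- /eqP.
  by rewrite subr_eq0 => /eqP <-; rewrite divr1 subrr.
have [i [j ea]] := theta_eq0 a0 ta; have [k [l eb]] := theta_eq0 b0 tb.
apply: (@theta_vanish _ (i + l) (j + k)) => //; first by rewrite mulf_neq0 ?invr_eq0.
by rewrite !exprD -ea -eb; field.
Qed.

(** An exact inversion formula for partial products, which share all factors except those at the two
    ends; the far ends [1 - p ^+ N * x] and [1 - p ^+ N / x] tend to [1]. *)
Lemma tprodV x N : x != 0 ->
  (1 - x) * (1 - p ^+ N / x) * tprod p x^-1 N = (1 - x^-1) * (1 - p ^+ N * x) * tprod p x N.
Proof.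
move=> x0; elim: N => [|N IH]; first by rewrite /tprod !big_nil; field.
have tS y : tprod p y N.+1 = tprod p y N * ((1 - p ^+ N * y) * (1 - p ^+ N.+1 / y)).
  by rewrite /tprod big_nat_recr.
rewrite !tS invrK.
have -> : (1 - x) * (1 - p ^+ N.+1 / x) *
    (tprod p x^-1 N * ((1 - p ^+ N / x) * (1 - p ^+ N.+1 * x))) =
    (1 - x) * (1 - p ^+ N / x) * tprod p x^-1 N * ((1 - p ^+ N.+1 / x) * (1 - p ^+ N.+1 * x)).
  by ring.
by rewrite IH; ring.
Qed.

Lemma theta_inv x : x != 0 -> th x^-1 = - (th x / x).
Proof.
move=> x0; have [->|x1] := eqVneq x 1; first by rewrite invr1 theta1 mul0r oppr0.
have x'0 : x^-1 != 0 by rewrite invr_eq0.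
have pN c : gconv r (fun N => 1 - p ^+ N * c) 1.
  exists (nm c) => N; rewrite addrC addKr nmN nmM mulrC.
  by rewrite ler_wpM2l ?nm_ge0 // nm_exp_le.
have cv y d : y != 0 -> gconv r (fun N => d * (1 - p ^+ N / y) * tprod p y^-1 N) (d * 1 * th y^-1).
  move=> y0; apply: gconvM => //; last by apply: theta_gconv; rewrite ?invr_eq0.
  by apply: gconvM => //; exact: gconv_cst.
have E1 := cv _ (1 - x) x0; have := cv _ (1 - x^-1) x'0; rewrite !invrK => E2.
have {E2}E2 := gconv_ext (fun N => esym (tprodV N x0)) E2.
have := gconv_uniq r0 r1 E1 E2; rewrite !mulr1 => E.
have x1' : 1 - x != 0 by rewrite subr_eq0 eq_sym.
by apply: (mulfI x1'); rewrite E; field.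
Qed.

(** Up to the factor [x / L ^+ 2], [theta (x * y) * theta (x / y)] is the limit of the two by two
    determinants [F x y N]; these satisfy the Pluecker relation for each [N], and uniqueness of
    limits transfers it. *)
Lemma theta_addition x y u v : x != 0 -> y != 0 -> u != 0 -> v != 0 ->
  th (x * y) * th (x / y) * th (u * v) * th (u / v)
  - th (x * v) * th (x / v) * th (u * y) * th (u / y)
  = u / y * th (y * v) * th (y / v) * th (x * u) * th (x / u).
Proof.
move=> x0 y0 u0 v0; have [p0|p0] := eqVneq p 0.
  by rewrite !theta_p0 //; field; rewrite v0 y0 u0.
have [L L0 thL] := theta_jacobi r0 r1 pr p0.
pose F a b N := bsum p a N * asum p b N - asum p a N * bsum p b N.
pose f a b := a^-1 * ((L * th (a * b)) * (L * th (a / b))).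
have Ff a b : a != 0 -> b != 0 -> gconv r (F a b) (f a b).
  move=> a0 b0.
  have ab0 : a * b != 0 by rewrite mulf_neq0.
  have ab0' : a / b != 0 by rewrite mulf_neq0 ?invr_eq0.
  have E := gconvM r0 r1 (thL _ ab0) (thL _ ab0').
  have := gconvD E (gconvN (product_gconv r0 r1 pr a0 b0)); rewrite oppr0 addr0 => {}E.
  apply: gconv_ext (gconvM r0 r1 (gconv_cst r a^-1) E) => N.
  rewrite /F; move: (ssum _ _ N) (ssum _ _ N) (bsum _ _ N) (asum _ _ N) => s1 s2 b1 a1.
  by move: (asum _ _ N) (bsum _ _ N) => a2 b2; field.
have E0 : gconv r (fun N => F x y N * F u v N - F x v N * F u y N - F y v N * F x u N)
   (f x y * f u v - f x v * f u y - f y v * f x u).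
  by apply: gconvD; [apply: gconvD; [|apply: gconvN]|apply: gconvN];
    apply: gconvM => //; apply: Ff.
have e : f x y * f u v - f x v * f u y - f y v * f x u = 0.
  apply: (gconv_uniq r0 r1 E0); apply: gconv_ext (gconv_cst r 0) => N.
  rewrite /F; move: (asum p x N) (asum p y N) (asum p u N) (asum p v N) => ax ay au av.
  by move: (bsum p x N) (bsum p y N) (bsum p u N) (bsum p v N) => bx by_ bu bv; ring.
apply/eqP; rewrite -subr_eq0; apply/eqP.
have -> : th (x * y) * th (x / y) * th (u * v) * th (u / v)
  - th (x * v) * th (x / v) * th (u * y) * th (u / y)
  - u / y * th (y * v) * th (y / v) * th (x * u) * th (x / u)
  = x * u / L ^+ 4 * (f x y * f u v - f x v * f u y - f y v * f x u).
  rewrite /f; move: (th (x * y)) (th (x / y)) (th (u * v)) (th (u / v)) => t1 t2 t3 t4.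
  move: (th (x * v)) (th (x / v)) (th (u * y)) (th (u / y)) => t5 t6 t7 t8.
  move: (th (y * v)) (th (y / v)) (th (x * u)) (th (x / u)) => t9 t10 t11 t12.
  by field; rewrite L0 y0 u0 x0.
by rewrite e mulr0.
Qed.

Lemma theta_theta_like : theta_like th.
Proof.
split; [exact: theta1|exact: theta_inv|exact: theta_div_eq0|].
(* Solving [x y = A], [x / y = B], [u v = C], [x v = E] takes the single square root
   [x ^+ 2 = A * B], which exists in [R[i]]; the other unknowns are rational in [x]. *)
move=> A B C E A0 B0 C0 E0; pose x := sqrtc (A * B).
have xx : x * x = A * B by rewrite -expr2 sqr_sqrtc.
have x0 : x != 0 by rewrite sqrtc_eq0 mulf_neq0.
have BE : B = x * x / A by rewrite xx; field.
have := @theta_addition x (A / x) (C * x / E) (E / x) x0.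
rewrite !mulf_neq0 ?invr_eq0 // => /(_ isT isT isT).
have -> : x * (A / x) = A by field.
have -> : x / (A / x) = B by rewrite BE; field; rewrite A0 x0.
have -> : C * x / E * (E / x) = C by field; rewrite E0 x0.
have -> : C * x / E / (E / x) = A * B * C / E ^+ 2 by rewrite BE; field; rewrite A0 E0 x0.
have -> : x * (E / x) = E by field.
have -> : x / (E / x) = A * B / E by rewrite BE; field; rewrite A0 E0 x0.
have -> : C * x / E * (A / x) = A * C / E by field; rewrite E0 x0.
have -> : C * x / E / (A / x) = B * C / E by rewrite BE; field; rewrite A0 E0 x0.
have -> : A / x * (E / x) = E / B by rewrite BE; field; rewrite A0 x0.
have -> : A / x / (E / x) = A / E by field; rewrite E0 x0.
have -> : x * (C * x / E) = A * B * C / E by rewrite BE; field; rewrite A0 E0.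
have -> : x / (C * x / E) = E / C by field; rewrite C0 E0 x0.
by [].
Qed.

End ThetaIdentities.

(** * The duality for [theta] *)

Theorem theorem3p1 (R : realType) (p q : R[i]) (m n N : nat)
  (z : 'I_n -> R[i]) (w : 'I_m -> R[i]) (a : 'I_(m + n) -> R[i])
  (hp : `|p| < 1) (hq : q != 0)
  (hm : (1 <= m)%N) (hn : (1 <= n)%N)
  (hz : forall k, z k != 0) (hw : forall k, w k != 0)
  (ha : forall j, a j != 0)
  (hDz : Delta p z != 0) (hDw : Delta p w != 0)
  (hdenl : forall y : {ffun 'I_n -> 'I_N.+1}, composition y -> forall k,
    \prod_(j < m) ellpoch p q (w j * z k) (y k) *
    \prod_(j < n) ellpoch p q (q * z k / z j) (y k) != 0)
  (hdenr : forall y : {ffun 'I_m -> 'I_N.+1}, composition y -> forall k,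
    \prod_(j < n) ellpoch p q (w k * z j) (y k) *
    \prod_(j < m) ellpoch p q (q * w k / w j) (y k) != 0)
  (hbal : \prod_(j < m) w j = \prod_(k < n) z k * \prod_(j < m + n) a j) :
  \sum_(y : {ffun 'I_n -> 'I_N.+1} | composition y)
    Delta p (fun k => z k * q ^+ y k) / Delta p z *
    \prod_(k < n)
      (\prod_(j < m + n) ellpoch p q (a j * z k) (y k) /
       (\prod_(j < m) ellpoch p q (w j * z k) (y k) *
        \prod_(j < n) ellpoch p q (q * z k / z j) (y k))) =
  \sum_(y : {ffun 'I_m -> 'I_N.+1} | composition y)
    Delta p (fun k => w k * q ^+ y k) / Delta p w *
    \prod_(k < m)
      (\prod_(j < m + n) ellpoch p q (w k / a j) (y k) /
       (\prod_(j < n) ellpoch p q (w k * z j) (y k) *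
        \prod_(j < m) ellpoch p q (q * w k / w j) (y k))).
Proof.
have p1 : nm p < 1 by move: hp; rewrite nmE -(rmorph1 (real_complex R)) ltcR.
(* The midpoint of [nm p] and [1] is a positive rate even for [p = 0]. *)
pose r := (1 + nm p) / 2.
have r0 : 0 < r by have := nm_ge0 p; rewrite /r; lra.
have r1 : r < 1 by rewrite /r; lra.
have pr : nm p <= r by rewrite /r; lra.
have thP := theta_theta_like r0 r1 pr.
(* Placing all of [N] on one index exposes in a single denominator every theta factor needed for
   nonresonance and for [wz]. *)
have conc M (k : 'I_M) : exists2 y : {ffun 'I_M -> 'I_N.+1}, composition y & y k = N :> nat.
  exists [ffun j => if j == k then ord_max else ord0]; last by rewrite ffunE eqxx.
  rewrite /composition (bigD1 k) //= ffunE eqxx big1 ?addn0 // => j /negbTE jk.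
  by rewrite ffunE jk.
have gz : nonresonant (theta p) q N z.
  apply: nonresonant_of_neq0 => // _ j k; have [y cy yk] := conc n k.
  by have := hdenl y cy k; rewrite yk mulf_eq0 negb_or => /andP[_ /prodf_neq0/(_ j isT)].
have gw : nonresonant (theta p) q N w.
  apply: nonresonant_of_neq0 => // _ j k; have [y cy yk] := conc m k.
  by have := hdenr y cy k; rewrite yk mulf_eq0 negb_or => /andP[_ /prodf_neq0/(_ j isT)].
have wz i k l : (l < N)%N -> theta p (w i * q ^+ l * z k) != 0.
  move=> lN; have [y cy yk] := conc n k; have := hdenl y cy k.
  rewrite yk mulf_eq0 negb_or => /andP[/prodf_neq0/(_ i isT) + _].
  rewrite /ellpoch big_mkord => /prodf_neq0/(_ (Ordinal lN) isT).
  by rewrite /= mulrAC.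
pose cs := [seq a j | j <- enum 'I_(m + n)].
have szc : size cs = (m + n)%N by rewrite size_map size_enum_ord.
have cs0 : all (fun c => c != 0) cs by apply/allP => _ /mapP[j _ ->].
have csE (f : R[i] -> R[i]) : \prod_(c <- cs) f c = \prod_j f (a j).
  by rewrite big_map big_enum.
have bal : \prod_i w i = \prod_k z k * \prod_(c <- cs) c.
  by rewrite hbal /cs big_map big_enum.
have := duality_sum_dual thP hq (leqnn N) hn szc hz hw cs0 gz gw wz bal.
rewrite /duality_sum /composition_sum => E; apply: etrans (etrans _ E) _.
  apply: eq_bigr => y _; rewrite /weight -[RHS]mulrA; congr (_ * _).
  rewrite mulrC /pochs /onebody -prodf_div; apply: eq_bigr => k _.
  rewrite invfM mulrA; congr (_ / _).
  rewrite /primal_factor prodf_div; congr (_ / _); rewrite [RHS]exchange_big /=.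
    rewrite csE; apply: eq_bigr => j _; rewrite /ellpoch.
    by apply: eq_bigr => i _; rewrite mulrA.
  by apply: eq_bigr => j _; apply: eq_bigr => i _; rewrite mulrA.
apply: eq_bigr => y _; rewrite /weight -[LHS]mulrA; congr (_ * _).
rewrite mulrC /pochs /onebody -prodf_div; apply: eq_bigr => k _.
rewrite [in RHS]invfM mulrA; congr (_ / _).
rewrite /dual_factor prodf_div; congr (_ / _); rewrite [LHS]exchange_big /=.
  rewrite csE; apply: eq_bigr => j _; rewrite /ellpoch.
  by apply: eq_bigr => i _; rewrite mulrAC.
by apply: eq_bigr => j _; apply: eq_bigr => i _; rewrite mulrAC.
Qed.
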